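(* Let $F\in L^2(\mathbb{P}_1)$. If the map $\theta\mapsto F^\theta$ is differentiable in $L^2(\mathbb{P})$ at a certain point $\theta_0\in\mathbb{R}$, then $F$ belongs to $\mathbb{D}$.
   Context: $B$ is a standard one-dimensional Brownian motion on the Wiener space $(\Omega_1,\mathbb{P}_1)$. $M$ is a normal martingale (a square integrable martingale with $M_0=0$ and $\langle M,M\rangle_t=t$) defined under a probability $\mathbb{P}_2$; $\mathbb{P}=\mathbb{P}_1\times\mathbb{P}_2$, so $M$ is independent of $B$. For $\theta\in\mathbb{R}$, $Y^\theta_t=B_t\cos\theta+M_t\sin\theta$, a normal martingale with $Y^0=B$. For symmetric $f_n\in L^2(\mathbb{R}_+^n)$, $I_n(f_n)$ denotes the multiple stochastic integral with respect to $B$ and $I_n^\theta(f_n)=n!\int_{0<s_1<\cdots<s_n}f_n\,dY^\theta_{s_1}\cdots dY^\theta_{s_n}$ the one with respect to $Y^\theta$. If $F=\sum_{n\ge0} I_n(f_n)\in L^2(\mathbb{P}_1)$, its chaotic extension is $F^\theta=\sum_{n\ge0}I_n^\theta(f_n)\in L^2(\mathbb{P})$. $\mathbb{D}$ is the domain of the Ornstein-Uhlenbeck form on Wiener space: $F=\sum_n I_n(f_n)\in L^2(\mathbb{P}_1)$ belongs to $\mathbb{D}$ iff $\sum_n n\,n!\,\|f_n\|^2_{L^2}<\infty$. *)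

(* Defs.v *)
From HB Require Import structures.
From mathcomp Require Import all_boot all_order all_algebra all_fingroup.
From mathcomp Require Import all_classical all_reals all_analysis.

Set Implicit Arguments.
Unset Strict Implicit.
Unset Printing Implicit Defensive.

Import Order.TTheory GRing.Theory Num.Theory.
Import numFieldNormedType.Exports.

Local Open Scope classical_set_scope.
Local Open Scope ring_scope.

(* Conventions: a process is a map X : R -> T -> R of which only the times
   t >= 0 matter, and an element of L^2(mu) is given by a representative in
   [Lfun mu 2%:E]; limits and derivatives of random variables are taken in
   the L^2 norm. *)

Section L2.
Context d (T : measurableType d) (R : realType).
Variable mu : {measure set T -> \bar R}.

Definition L2norm (f : T -> R) : \bar R := 'N[mu]_2%:E[EFin \o f].

Definition L2_converges (X_ : nat -> T -> R) (X : T -> R) : Prop :=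
  (fun k => L2norm (X_ k \- X)) @ \oo --> 0%E.

Definition L2_differentiable_at (Phi : R -> T -> R) (x0 : R) : Prop :=
  exists2 DPhi : T -> R, DPhi \in Lfun mu 2%:E &
    L2norm (fun w => h^-1 * (Phi (x0 + h) w - Phi x0 w) - DPhi w)
      @[h --> 0^'] --> 0%E.

End L2.

Section lebesgue_tuple.
Context (R : realType).

Definition tuple_cons n (p : n.-tuple R * measurableTypeR R) : n.+1.-tuple R :=
  [tuple of p.2 :: p.1].

Lemma measurable_tuple_cons n : measurable_fun [set: _] (@tuple_cons n).
Proof. exact: measurable_cons. Qed.

(* The pushforward of m \x lebesgue_measure by tuple_cons, with its structure
   of measure (which depends on a proof of measurability). *)
Definition lebesgue_tuple_next n (m : {measure set (n.-tuple R) -> \bar R}) :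
    {measure set (n.+1.-tuple R) -> \bar R} :=
  measure_function_pushforward__canonical__measure_function_Measure
    (m \x lebesgue_measure)%E (@measurable_tuple_cons n).

(* Lebesgue measure on R^n; for n = 0 it is the unit mass on the point. *)
Fixpoint lebesgue_tuple n : {measure set (n.-tuple R) -> \bar R} :=
  match n with
  | 0 => dirac [tuple]
  | n'.+1 => lebesgue_tuple_next (lebesgue_tuple n')
  end.

Definition orthant n : set (n.-tuple R) := [set x | forall i, 0 <= tnth x i].

Definition open_simplex n : set (n.-tuple R) :=
  [set x | (forall i, 0 < tnth x i) /\
           (forall i j : 'I_n, (i < j)%N -> tnth x i < tnth x j)].

(* Kernels are functions on R_+^n: their values off the orthant are ignored. *)
Definition kernel_norm n (f : n.-tuple R -> R) : \bar R :=
  L2norm (lebesgue_tuple n) (f \_ (@orthant n)).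

Definition symmetric_L2_kernel n (f : n.-tuple R -> R) : Prop :=
  f \_ (@orthant n) \in Lfun (lebesgue_tuple n) 2%:E /\
  forall (s : {perm 'I_n}) x, orthant x -> f [tuple tnth x (s i) | i < n] = f x.

End lebesgue_tuple.

Section martingale.
Context d (T : measurableType d) (R : realType).
Variable P : probability T R.

Definition filtration (G : R -> set (set T)) : Prop :=
  [/\ forall t, 0 <= t -> sigma_algebra setT (G t),
      forall t, 0 <= t -> G t `<=` measurable
    & forall s t, 0 <= s -> s <= t -> G s `<=` G t].

(* E[X_t | G_s] = X_s is expressed by testing against every event of G_s. *)
Definition martingale (G : R -> set (set T)) (X : R -> T -> R) : Prop :=
  [/\ forall t, 0 <= t -> X t \in Lfun P 1%:E,
      forall t, 0 <= t -> forall U, measurable U -> G t (X t @^-1` U)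
    & forall s t A, 0 <= s -> s <= t -> G s A ->
        (\int[P]_(w in A) (X t w)%:E = \int[P]_(w in A) (X s w)%:E)%E].

(* <M, M>_t = t: the process t |-> t is predictable (it is deterministic and
   continuous), increasing and null at 0, so this says that M_t^2 - t is a
   martingale. *)
Definition normal_martingale (G : R -> set (set T)) (M : R -> T -> R) : Prop :=
  [/\ martingale G M,
      forall t, 0 <= t -> M t \in Lfun P 2%:E,
      {ae P, forall w, M 0 w = 0}
    & martingale G (fun t w => M t w ^+ 2 - t)].

End martingale.

Section wiener.
Context d (T : measurableType d) (R : realType).
Variable P : probability T R.

Definition generated_by (X : R -> T -> R) (I : set R) : set (set T) :=
  <<s [set A | exists2 r, I r & exists2 U, measurable U & A = X r @^-1` U] >>.

Definition brownian_motion (B : R -> T -> R) : Prop :=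
  [/\ forall t, 0 <= t -> measurable_fun setT (B t),
      {ae P, forall w, B 0 w = 0},
      {ae P, forall w, {within `[0, +oo[, continuous (B ^~ w)}}
    & forall s t A U, 0 <= s -> s < t ->
        generated_by B `[0, s] A -> measurable U ->
        P (A `&` [set w | U (B t w - B s w)]) =
          (P A * normal_prob 0 (Num.sqrt (t - s)) U)%E].

(* A probability space is a Wiener space for B when B is a Brownian motion
   generating all events, up to P-null sets (so that completing the canonical
   space of continuous paths is allowed). *)
Definition wiener_space (B : R -> T -> R) : Prop :=
  brownian_motion B /\
  forall A, measurable A -> exists2 A',
    generated_by B `[0, +oo[ A' & P ((A `\` A') `|` (A' `\` A)) = 0%E.

End wiener.

Section multiple_integral.
Context (R : realType) (n : nat).

(* The box ]a_1, b_1] x ... x ]a_n, b_n] is given by the pairs (a_i, b_i). *)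
Definition box (I : n.-tuple (R * R)) : set (n.-tuple R) :=
  [set x | forall i, (tnth I i).1 < tnth x i <= (tnth I i).2].

(* 0 <= a_1 <= b_1 <= a_2 <= b_2 <= ...: the box lies in the open simplex. *)
Definition ordered_box (I : n.-tuple (R * R)) : Prop :=
  (forall i, 0 <= (tnth I i).1 <= (tnth I i).2) /\
  (forall i j : 'I_n, (i < j)%N -> (tnth I i).2 <= (tnth I j).1).

Definition step_kernel (s : seq (R * n.-tuple (R * R))) (x : n.-tuple R) : R :=
  \sum_(c <- s) c.1 * \1_(box c.2) x.

Context d (T : measurableType d).
Variable mu : {measure set T -> \bar R}.

Definition step_integral (Y : R -> T -> R) (s : seq (R * n.-tuple (R * R)))
    (w : T) : R :=
  \sum_(c <- s) c.1 *
    \prod_(i < n) (Y (tnth c.2 i).2 w - Y (tnth c.2 i).1 w).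

(* The L^2-extension of step_integral:
     Z = \int_(0 < s_1 < ... < s_n) f dY_(s_1) ... dY_(s_n).
   Step kernels on ordered boxes are dense in L^2 of the simplex and, for a
   normal martingale Y, step_integral is an isometry on them. *)
Definition iterated_integral (Y : R -> T -> R) (f : n.-tuple R -> R)
    (Z : T -> R) : Prop :=
  Z \in Lfun mu 2%:E /\
  exists s : nat -> seq (R * n.-tuple (R * R)),
    [/\ forall k, {in s k, forall c, ordered_box c.2},
        L2_converges (lebesgue_tuple R n) (fun k => step_kernel (s k))
          (f \_ (@open_simplex R n))
      & L2_converges mu (fun k => step_integral Y (s k)) Z].

Definition multiple_integral (Y : R -> T -> R) (f : n.-tuple R -> R)
    (X : T -> R) : Prop :=
  exists2 Z, iterated_integral Y f Z & X = (fun w => n`!%:R * Z w).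

End multiple_integral.

Section chaos.
Context (R : realType).

(* F = \sum_n I_n(f_n) in L^2(mu), the integrals being with respect to Y. *)
Definition chaos_sum d (T : measurableType d) (mu : {measure set T -> \bar R})
    (Y : R -> T -> R) (f : forall n, n.-tuple R -> R) (F : T -> R) : Prop :=
  F \in Lfun mu 2%:E /\
  exists2 X : nat -> T -> R,
    forall n, multiple_integral mu Y (f n) (X n) &
    L2_converges mu (fun N w => \sum_(n < N) X n w) F.

Definition OU_domain d (T : measurableType d) (P : probability T R)
    (B : R -> T -> R) (F : T -> R) : Prop :=
  exists f : forall n, n.-tuple R -> R,
    [/\ forall n, symmetric_L2_kernel (f n),
        chaos_sum P B f F
      & (\sum_(0 <= n <oo) (n * n`!)%:R%:E * kernel_norm (f n) ^+ 2 < +oo)%E].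

Context d1 d2 (W1 : measurableType d1) (W2 : measurableType d2).
Variables (P1 : probability W1 R) (P2 : probability W2 R).
Variables (B : R -> W1 -> R) (M : R -> W2 -> R).

Definition rotated_martingale (theta t : R) (w : W1 * W2) : R :=
  B t w.1 * cos theta + M t w.2 * sin theta.

(* Fx theta is (a version of) the chaotic extension F^theta of F. *)
Definition chaotic_extension (F : W1 -> R) (Fx : R -> W1 * W2 -> R) : Prop :=
  exists f : forall n, n.-tuple R -> R,
    [/\ forall n, symmetric_L2_kernel (f n),
        chaos_sum P1 B f F
      & forall theta,
          chaos_sum (P1 \x P2)%E (rotated_martingale theta) f (Fx theta)].

End chaos.

(* Main.v *)
Require Import Defs.
From mathcomp Require Import all_boot all_order all_algebra all_fingroup.
From mathcomp Require Import all_classical all_reals all_analysis.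
From mathcomp Require Import measurable_realfun.
From mathcomp Require Import ring lra.

(* Conditionally on the past, the increments of Y^theta and Y^theta' over
   ]s, t] have mean 0 and covariance cos (theta - theta') (t - s): B and M are
   independent and each has conditional variance t - s. Hence multiple integrals
   of different orders are orthogonal, and with a_n the squared norm of
   I_n(f_n),
     E (I_n^theta(f_n) I_n^theta'(f_n)) = cos (theta - theta') ^ n a_n,
     ||F^(theta + h) - F^theta||^2 = sum_n 2 (1 - cos h ^ n) a_n.
   Differentiability at theta bounds the right-hand side by C h^2 for small h.
   As (1 - cos h ^ n) / h^2 tends to n / 2, each finite sum of the n a_n is
   bounded by a constant multiple of C. *)

Set Implicit Arguments.
Unset Strict Implicit.
Unset Printing Implicit Defensive.

Import Order.TTheory GRing.Theory Num.Theory.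
Import numFieldNormedType.Exports.

Local Open Scope classical_set_scope.
Local Open Scope ring_scope.

(** * The real inner product of L^2 *)

Section inner_product.
Context d (T : measurableType d) (R : realType).
Variable mu : {measure set T -> \bar R}.
Implicit Types f g h : T -> R.

Local Notation L2 := (Lfun mu 2%:E).

Lemma one_le_two : (1 <= 2%:E :> \bar R)%E.
Proof. by rewrite lee_fin ler1n. Qed.

Lemma L2_measurable f : f \in L2 -> measurable_fun setT f.
Proof. by rewrite inE => /andP[/[!inE]]. Qed.

Lemma eq_L2 f g : f =1 g -> f \in L2 -> g \in L2.
Proof. by move=> /funext ->. Qed.

Lemma L2D f g : f \in L2 -> g \in L2 -> (fun x => f x + g x) \in L2.
Proof. exact: (Lfun_addr_closed mu one_le_two).2. Qed.

Lemma L2Z a f : f \in L2 -> (fun x => a * f x) \in L2.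
Proof.
move=> fL; apply: eq_L2 (@Lfun_scale _ _ _ mu f a 2 (ler1n _ 2) fL) => x /=.
by rewrite mulrC.
Qed.

Lemma L2B f g : f \in L2 -> g \in L2 -> (fun x => f x - g x) \in L2.
Proof.
move=> fL /(L2Z (-1)) gL; apply: eq_L2 (L2D fL gL) => x /=.
by rewrite mulN1r.
Qed.

Lemma L20 : (fun=> 0) \in L2.
Proof. exact: (Lfun_submod_closed mu one_le_two).1. Qed.

Lemma L2_sum (I : eqType) (s : seq I) (F : I -> T -> R) :
  {in s, forall i, F i \in L2} -> (fun x => \sum_(i <- s) F i x) \in L2.
Proof.
elim: s => [_|i s IH sL].
  by apply: eq_L2 L20 => x; rewrite big_nil.
apply: (eq_L2 (fun x => esym (big_cons _ _ _ _ _ _))) => /=.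
by apply: L2D; [|apply: IH => j js]; apply: sL; rewrite inE ?eqxx ?js ?orbT.
Qed.

Lemma L2_sqr_integrableP f : measurable_fun setT f ->
  mu.-integrable setT (fun x => (f x ^+ 2)%:E) -> f \in L2.
Proof.
move=> mf /integrableP[_ fi]; rewrite inE; apply/andP; split; rewrite inE//=.
rewrite /finite_norm unlock poweR_lty//; move: fi.
apply: le_lt_trans; rewrite le_eqVlt; apply/orP; left; apply/eqP.
apply: eq_integral => x _ /=.
by rewrite powR_mulrn// -normrX.
Qed.

Definition ip f g : R := \int[mu]_x (f x * g x).

Lemma ipC f g : ip f g = ip g f.
Proof. by apply: eq_Rintegral => x _; rewrite mulrC. Qed.

Lemma ip_integrable f g : f \in L2 -> g \in L2 ->
  mu.-integrable setT (EFin \o (fun x => f x * g x)).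
Proof. by move=> fL gL; apply/Lfun1_integrable; exact: Lfun2_mul_Lfun1. Qed.

Lemma ipDl f g h : f \in L2 -> g \in L2 -> h \in L2 ->
  ip (fun x => f x + g x) h = ip f h + ip g h.
Proof.
move=> fL gL hL; rewrite /ip -RintegralD//; try exact: ip_integrable.
by apply: eq_Rintegral => x _; rewrite mulrDl.
Qed.

Lemma ipZl a f g : f \in L2 -> g \in L2 -> ip (fun x => a * f x) g = a * ip f g.
Proof.
move=> fL gL; rewrite /ip -RintegralZl//; last exact: ip_integrable.
by apply: eq_Rintegral => x _; rewrite mulrA.
Qed.

Lemma ipBl f g h : f \in L2 -> g \in L2 -> h \in L2 ->
  ip (fun x => f x - g x) h = ip f h - ip g h.
Proof.
move=> fL gL hL; rewrite /ip -RintegralB//; try exact: ip_integrable.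
by apply: eq_Rintegral => x _; rewrite mulrBl.
Qed.

Lemma ipDr f g h : f \in L2 -> g \in L2 -> h \in L2 ->
  ip h (fun x => f x + g x) = ip h f + ip h g.
Proof. by move=> *; rewrite ipC ipDl// !(ipC h). Qed.

Lemma ipZr a f g : f \in L2 -> g \in L2 -> ip g (fun x => a * f x) = a * ip g f.
Proof. by move=> *; rewrite ipC ipZl// (ipC g). Qed.

Lemma ipBr f g h : f \in L2 -> g \in L2 -> h \in L2 ->
  ip h (fun x => f x - g x) = ip h f - ip h g.
Proof. by move=> *; rewrite ipC ipBl// !(ipC h). Qed.

Lemma ip0l g : ip (fun=> 0) g = 0.
Proof.
rewrite /ip /Rintegral (eq_integral (cst 0%E)) ?integral0// => x _.
by rewrite mul0r.
Qed.

Lemma ip_suml (I : eqType) (s : seq I) (F : I -> T -> R) g :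
  {in s, forall i, F i \in L2} -> g \in L2 ->
  ip (fun x => \sum_(i <- s) F i x) g = \sum_(i <- s) ip (F i) g.
Proof.
move=> + gL; elim: s => [_|i s IH sL].
  rewrite big_nil -[RHS](ip0l g); congr ip.
  by apply/funext => x; rewrite big_nil.
have sL' : {in s, forall i, F i \in L2}.
  by move=> j js; apply: sL; rewrite inE js orbT.
rewrite big_cons -IH// -ipDl//; [|by apply: sL; exact: mem_head|exact: L2_sum].
by congr ip; apply/funext => x; rewrite big_cons.
Qed.

Lemma ip_sumr (I : eqType) (s : seq I) (F : I -> T -> R) g :
  {in s, forall i, F i \in L2} -> g \in L2 ->
  ip g (fun x => \sum_(i <- s) F i x) = \sum_(i <- s) ip g (F i).
Proof.
by move=> sL gL; rewrite ipC ip_suml//; apply: eq_bigr => i _; rewrite ipC.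
Qed.

Lemma ip_ge0 f : 0 <= ip f f.
Proof. by apply: Rintegral_ge0 => x _; rewrite -expr2 sqr_ge0. Qed.

Lemma L2norm_sqrt f : f \in L2 -> L2norm mu f = (Num.sqrt (ip f f))%:E.
Proof.
move=> fL; rewrite /L2norm unlock -powR12_sqrt ?ip_ge0// -poweR_EFin.
congr poweR; rewrite /ip /Rintegral fineK; last first.
  exact: integrable_fin_num (ip_integrable fL fL).
by apply: eq_integral => x _ /=; rewrite powR_mulrn// -normrX ger0_norm ?sqr_ge0.
Qed.

Lemma L2norm_sqr f : f \in L2 -> (L2norm mu f ^+ 2)%E = (ip f f)%:E.
Proof.
by move=> /L2norm_sqrt ->; rewrite -EFin_expe sqr_sqrtr// ip_ge0.
Qed.

Lemma ip_CauchySchwarz f g : f \in L2 -> g \in L2 ->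
  `|ip f g| <= Num.sqrt (ip f f) * Num.sqrt (ip g g).
Proof.
move=> fL gL; rewrite -sqrtrM ?ip_ge0// -sqrtr_sqr ler_wsqrtr//.
have pos t : 0 <= ip f f - 2 * t * ip f g + t ^+ 2 * ip g g.
  have tL := L2Z t gL.
  have := ip_ge0 (fun x => f x - t * g x).
  rewrite ipBl ?ipBr ?ipZl ?ipZr ?(L2B fL)// (ipC g f) => /le_trans; apply.
  by rewrite le_eqVlt; apply/orP; left; apply/eqP; ring.
have [g0|g0] := eqVneq (ip g g) 0.
  rewrite g0 mulr0; have [->|fg0] := eqVneq (ip f g) 0; first by rewrite expr0n.
  have := pos ((ip f f + 1) / (2 * ip f g)).
  rewrite g0 mulr0 addr0.
  rewrite (_ : 2 * _ * _ = ip f f + 1); last by field.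
  lra.
have := pos (ip f g / ip g g); have gp : 0 < ip g g by rewrite lt_neqAle eq_sym g0 ip_ge0.
rewrite (_ : ip f f - _ + _ = ip f f - ip f g ^+ 2 / ip g g); last by field.
by rewrite subr_ge0 ler_pdivrMr.
Qed.

Lemma L2_converges_ip (X_ : nat -> T -> R) X : (forall k, X_ k \in L2) ->
  X \in L2 -> L2_converges mu X_ X ->
  (fun k => Num.sqrt (ip (fun x => X_ k x - X x) (fun x => X_ k x - X x)))
    @ \oo --> (0 : R).
Proof.
move=> XkL XL; rewrite /L2_converges => /fine_cvgP[_ /=].
apply: cvg_trans; apply: near_eq_cvg; apply: nearW => k /=.
by rewrite L2norm_sqrt//; exact: L2B.
Qed.

Lemma cvg_ip (X_ Y_ : nat -> T -> R) X Y : (forall k, X_ k \in L2) ->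
  X \in L2 -> (forall k, Y_ k \in L2) -> Y \in L2 ->
  L2_converges mu X_ X -> L2_converges mu Y_ Y ->
  (fun k => ip (X_ k) (Y_ k)) @ \oo --> ip X Y.
Proof.
move=> XkL XL YkL YL /L2_converges_ip-/(_ XkL XL) cX.
move=> /L2_converges_ip-/(_ YkL YL) cY.
set a := (fun k => _) in cX; set b := (fun k => _) in cY.
have XBL k := L2B (XkL k) XL; have YBL k := L2B (YkL k) YL.
have dominated k : `|ip (X_ k) (Y_ k) - ip X Y| <=
    a k * b k + a k * Num.sqrt (ip Y Y) + Num.sqrt (ip X X) * b k.
  have -> : ip (X_ k) (Y_ k) - ip X Y =
      ip (fun x => X_ k x - X x) (fun x => Y_ k x - Y x) +
      ip (fun x => X_ k x - X x) Y + ip X (fun x => Y_ k x - Y x).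
    by rewrite ipBl// !ipBr// ipBl//; ring.
  rewrite (le_trans (ler_normD _ _))// lerD//; last exact: ip_CauchySchwarz.
  by rewrite (le_trans (ler_normD _ _))// lerD//; exact: ip_CauchySchwarz.
have c0 : (fun k => a k * b k + a k * Num.sqrt (ip Y Y) + Num.sqrt (ip X X) * b k)
    @ \oo --> (0 : R).
  rewrite (_ : 0 = 0 * 0 + 0 * Num.sqrt (ip Y Y) + Num.sqrt (ip X X) * 0); last ring.
  apply: cvgD; [apply: cvgD|]; [exact: cvgM|apply: cvgM|apply: cvgM] => //;
  exact: cvg_cst.
apply/cvgrPdistC_lt => e e0.
move/cvgr0_norm_lt : c0 => /(_ e e0); apply: filterS => k; apply: le_lt_trans.
exact: le_trans (dominated k) (ler_norm _).
Qed.

End inner_product.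

(** * Integrals against a sub-sigma-algebra *)

Section integral_mul_fimfun.
Context d (T : measurableType d) (R : realType).
Variable mu : {measure set T -> \bar R}.

Lemma ge0_integral_mul_fimfun (h : {fimfun T >-> R}) (f : T -> R) :
  (forall x, 0 <= h x) -> (forall r, measurable (h @^-1` [set r])) ->
  measurable_fun setT f -> (forall x, 0 <= f x) ->
  (\int[mu]_x (h x * f x)%:E =
   \sum_(r \in range h) r%:E * \int[mu]_(x in h @^-1` [set r]) (f x)%:E)%E.
Proof.
move=> h0 mh mf f0.
have h1 r x : 0 <= r * \1_(h @^-1` [set r]) x.
  rewrite indicE; have [xr|_] := boolP (x \in _); last by rewrite mulr0.
  by rewrite mulr1 -(set_mem xr).
transitivity (\int[mu]_x
    (\sum_(r \in range h) (r%:E * ((f x)%:E * (\1_(h @^-1` [set r]) x)%:E)))%E)%E.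
  apply: eq_integral => x _; rewrite {1}fimfunE EFinM -fsumEFin//.
  rewrite ge0_mule_fsuml => [|y]; last by rewrite lee_fin.
  by apply: eq_fsbigr => r _; rewrite EFinM -muleA (muleC (f x)%:E).
have mf1 r : measurable_fun setT (fun x => (f x)%:E * (\1_(h @^-1` [set r]) x)%:E)%E.
  by apply: emeasurable_funM; apply/measurable_EFinP => //; exact: measurable_indic.
rewrite ge0_integral_fsum//; last 2 first.
- by move=> r; apply: emeasurable_funM => //; exact: measurable_cst.
- move=> r x _; rewrite muleCA mule_ge0 ?lee_fin//.
apply: eq_fsbigr => r; rewrite inE => -[y _ <-].
rewrite ge0_integralZl//; first last.
- by rewrite lee_fin.
- by move=> x _; rewrite -EFinM lee_fin mulr_ge0.
congr (_ * _)%E; rewrite [RHS]integral_mkcond; apply: eq_integral => x _.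
by rewrite epatch_indic.
Qed.

End integral_mul_fimfun.

Section sub_sigma_algebra.
Context d (T : measurableType d) (R : realType).
Variables (mu : {measure set T -> \bar R}) (K : set (set T)).
Hypothesis subK : <<s K >> `<=` measurable.

Local Notation TK := (g_sigma_algebraType K).

Lemma sub_measurable_fun d' (U : measurableType d') (f : T -> U) :
  measurable_fun setT (f : TK -> U) -> measurable_fun setT f.
Proof.
move=> mf _ Y mY; rewrite setTI; apply: subK.
by have := mf measurableT Y mY; rewrite setTI.
Qed.

Import HBNNSimple.

Lemma ge0_integral_mul_sub (f g Z : T -> R) :
  measurable_fun setT f -> measurable_fun setT g ->
  (forall x, 0 <= f x) -> (forall x, 0 <= g x) ->
  measurable_fun setT (Z : TK -> R) -> (forall x, 0 <= Z x) ->
  (forall A, <<s K >> A ->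
    \int[mu]_(x in A) (f x)%:E = \int[mu]_(x in A) (g x)%:E)%E ->
  (\int[mu]_x (Z x * f x)%:E = \int[mu]_x (Z x * g x)%:E)%E.
Proof.
move=> mf mg f0 g0 mZ Z0 fg.
have mZE : measurable_fun (setT : set TK) (EFin \o Z).
  exact/measurable_EFinP.
pose h := nnsfun_approx measurableT mZE.
have mh n : measurable_fun setT (h n : T -> R).
  by apply: sub_measurable_fun; exact: measurable_funP.
have lim_h (k : T -> R) : measurable_fun setT k -> (forall x, 0 <= k x) ->
    (\int[mu]_x (Z x * k x)%:E = limn (fun n => \int[mu]_x (h n x * k x)%:E))%E.
  move=> mk k0; rewrite -monotone_convergence//.
  - apply: eq_integral => x _; apply/esym/cvg_lim => //.
    under eq_fun do rewrite EFinM.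
    rewrite EFinM; apply: cvgeZr => //.
    by apply: cvg_nnsfun_approx => // y _; rewrite lee_fin.
  - by move=> n; apply/measurable_EFinP; exact: measurable_funM.
  - by move=> n x _; rewrite lee_fin mulr_ge0.
  - move=> x _ a b ab; rewrite lee_fin ler_wpM2r//.
    by have /lefP/(_ x) := nd_nnsfun_approx measurableT mZE ab.
rewrite !lim_h//; congr (limn _); apply/funext => n.
have mhr r : measurable (h n @^-1` [set r] : set T).
  by apply: subK; exact: (measurable_funPTI (h n)).
have h0 x : 0 <= h n x by exact: fun_ge0.
have fimE k := @ge0_integral_mul_fimfun _ T R mu (h n) k h0 mhr.
rewrite !fimE//; apply: eq_fsbigr => r _; congr (_ * _)%E.
by apply: fg; exact: (measurable_funPTI (h n)).
Qed.

Lemma integral_mul_sub_eq0 (g Z : T -> R) :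
  measurable_fun setT (Z : TK -> R) -> mu.-integrable setT (EFin \o g) ->
  mu.-integrable setT (fun x => (Z x * g x)%:E) ->
  (forall A, <<s K >> A -> \int[mu]_(x in A) (g x)%:E = 0)%E ->
  \int[mu]_x (Z x * g x) = 0.
Proof.
move=> mZ ig iZg g0.
have mg : measurable_fun setT g by apply/measurable_EFinP; exact: measurable_int ig.
pose pos (u : T -> R) x : R := Num.max (u x) 0.
pose neg (u : T -> R) x : R := Num.max (- u x) 0.
have posE u x : pos u x - neg u x = u x.
  by rewrite /pos /neg; case: (leP (u x) 0) => ?; case: leP => ?; lra.
have absE u x : pos u x + neg u x = `|u x|.
  rewrite /pos /neg; have [u0|u0] := lerP 0 (u x).
    by rewrite max_r ?oppr_le0 ?addr0 ?ger0_norm.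
  by rewrite max_l ?oppr_ge0 ?(ltW u0)// add0r ltr0_norm.
have pos0 u x : 0 <= pos u x by rewrite le_max lexx orbT.
have neg0 u x : 0 <= neg u x by rewrite le_max lexx orbT.
have mpos u : measurable_fun setT u -> measurable_fun setT (pos u).
  by move=> mu_; exact: measurable_maxr.
have mneg u : measurable_fun setT u -> measurable_fun setT (neg u).
  by move=> mu_; apply: measurable_maxr => //; exact: measurableT_comp.
have dom (u v : T -> R) : measurable_fun setT u -> mu.-integrable setT (EFin \o v) ->
    (forall x, `|u x| <= `|v x|) -> mu.-integrable setT (EFin \o u).
  move=> mu_ iv uv; apply: le_integrable iv => //; first exact/measurable_EFinP.
  by move=> x _; rewrite lee_fin.
have nb u x : `|pos u x| <= `|u x| by rewrite -(absE u) ger0_norm// lerDl.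
have nb' u x : `|neg u x| <= `|u x| by rewrite -(absE u) ger0_norm// lerDr.
have ip_ := dom _ _ (mpos _ mg) ig (nb g).
have in_ := dom _ _ (mneg _ mg) ig (nb' g).
have gpn A : <<s K >> A ->
    (\int[mu]_(x in A) (pos g x)%:E = \int[mu]_(x in A) (neg g x)%:E)%E.
  move=> KA; have mA := subK KA; have := g0 _ KA.
  have -> : (\int[mu]_(x in A) (g x)%:E =
    \int[mu]_(x in A) (pos g x)%:E - \int[mu]_(x in A) (neg g x)%:E)%E.
    rewrite -integralB//; try exact: integrableS (subsetT _) _ => //.
    by apply: eq_integral => x _; rewrite -EFinB posE.
  move/eqP; rewrite sube_eq ?add0e; first by move/eqP.
    exact: integrable_fin_num (integrableS _ _ (subsetT _) ip_).
  by rewrite fin_num_adde_defr// (integrable_fin_num (integrableS _ _ (subsetT _) in_)).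
have mZT := sub_measurable_fun mZ.
have mZK : measurable_fun setT (pos Z : TK -> R) by exact: measurable_maxr.
have mZK' : measurable_fun setT (neg Z : TK -> R).
  by apply: measurable_maxr => //; exact: measurableT_comp.
have EP := ge0_integral_mul_sub (mpos _ mg) (mneg _ mg) (pos0 g) (neg0 g) mZK (pos0 Z) gpn.
have EN := ge0_integral_mul_sub (mpos _ mg) (mneg _ mg) (pos0 g) (neg0 g) mZK' (neg0 Z) gpn.
have i_ (u v : T -> R) : measurable_fun setT u -> measurable_fun setT v ->
    (forall x, `|u x| <= `|Z x|) -> (forall x, `|v x| <= `|g x|) ->
    mu.-integrable setT (EFin \o (fun x => u x * v x)).
  move=> mu_ mv uZ vg; apply: dom iZg _ => //; first exact: measurable_funM.
  by move=> x; rewrite !normrM ler_pM.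
rewrite /Rintegral.
transitivity (\int[mu]_x ((pos Z x * pos g x - pos Z x * neg g x) -
                          (neg Z x * pos g x - neg Z x * neg g x))).
  apply: eq_Rintegral => x _.
  by rewrite -{1}(posE Z x) -{1}(posE g x); ring.
have [mpZ mnZ] := (mpos _ mZT, mneg _ mZT).
have [mpg mng] := (mpos _ mg, mneg _ mg).
have ipp := i_ _ _ mpZ mpg (nb Z) (nb g); have ipn := i_ _ _ mpZ mng (nb Z) (nb' g).
have inp := i_ _ _ mnZ mpg (nb' Z) (nb g); have inn := i_ _ _ mnZ mng (nb' Z) (nb' g).
rewrite RintegralB//; [|have := integrableB measurableT ipp ipn
                       |have := integrableB measurableT inp inn] => //.
by rewrite !RintegralB// /Rintegral EP EN !subrr.
Qed.

End sub_sigma_algebra.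

(** * Processes with orthogonal normal increments *)

Section normal_increments.
Context d (T : measurableType d) (R : realType).
Variables (P : {measure set T -> \bar R}) (K : R -> set (set T)).
Hypothesis PT : P setT = 1%E.
Hypothesis subK : forall s : R, 0 <= s -> <<s K s >> `<=` measurable.
Hypothesis ndK : forall s t : R, 0 <= s -> s <= t -> <<s K s >> `<=` <<s K t >>.

Local Notation L2 := (Lfun P 2%:E).

Definition incr (X : R -> T -> R) s t w := X t w - X s w.

Definition adapted s (Z : T -> R) :=
  measurable_fun setT (Z : g_sigma_algebraType (K s) -> R).

Definition L2_adapted s Z := Z \in L2 /\ adapted s Z.

Record normal_incr (X : R -> T -> R) : Prop := NormalIncr {
  normal_incr_adapted : forall t, 0 <= t -> adapted t (X t);
  normal_incr_L2 : forall s t, 0 <= s -> s <= t -> incr X s t \in L2;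
  normal_incr_mean : forall s t A, 0 <= s -> s <= t -> <<s K s >> A ->
    (\int[P]_(w in A) (incr X s t w)%:E = 0)%E;
  normal_incr_var : forall s t A, 0 <= s -> s <= t -> <<s K s >> A ->
    (\int[P]_(w in A) (incr X s t w ^+ 2)%:E = \int[P]_(w in A) (t - s)%:E)%E }.

Definition correlated_incr (c : R) (X Y : R -> T -> R) : Prop :=
  forall s t A, 0 <= s -> s <= t -> <<s K s >> A ->
    (\int[P]_(w in A) (incr X s t w * incr Y s t w - c * (t - s))%:E = 0)%E.

Lemma correlated_incrC c X Y : correlated_incr c X Y -> correlated_incr c Y X.
Proof.
move=> XY s t A s0 st KA; rewrite -[RHS](XY s t A s0 st KA).
by apply: eq_integral => w _; rewrite [in RHS]mulrC.
Qed.

Lemma adaptedW s t Z : 0 <= s -> s <= t -> adapted s Z -> adapted t Z.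
Proof. by move=> s0 st mZ _ Y mY; exact: (ndK s0 st (mZ measurableT Y mY)). Qed.

Lemma L2_adaptedW s t Z : 0 <= s -> s <= t -> L2_adapted s Z -> L2_adapted t Z.
Proof. by move=> s0 st [ZL mZ]; split => //; exact: adaptedW mZ. Qed.

Lemma L2_cst (a : R) : cst a \in L2.
Proof.
apply: L2_sqr_integrableP => //; apply/integrableP; split => //=.
by rewrite integral_cst// PT mule1 ltry.
Qed.

Lemma L2_adapted_cst s a : L2_adapted s (cst a).
Proof. by split; [exact: L2_cst|exact: measurable_cst]. Qed.

Lemma incr_split X s t u w : incr X s u w = incr X s t w + incr X t u w.
Proof. by rewrite /incr; ring. Qed.

Lemma L2_adapted_mul_incr X s t Z : normal_incr X -> 0 <= s -> s <= t ->
  L2_adapted s Z -> L2_adapted t (fun w => Z w * incr X s t w).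
Proof.
move=> nX s0 st [ZL mZ]; have t0 := le_trans s0 st.
have mX r : 0 <= r -> r <= t -> adapted t (X r).
  by move=> r0 rt; apply: adaptedW rt _ => //; exact: normal_incr_adapted.
have aZX : adapted t (fun w => Z w * incr X s t w).
  apply: measurable_funM; first exact: adaptedW mZ.
  by apply: measurable_funB; exact: mX.
split => //; apply: L2_sqr_integrableP; first exact: (sub_measurable_fun (subK t0)) aZX.
have mZ2 : measurable_fun setT ((fun w => Z w ^+ 2) : g_sigma_algebraType (K s) -> R).
  exact: measurable_funX.
have mX2 := measurable_funX 2 (L2_measurable (normal_incr_L2 nX s0 st)).
apply/integrableP; split.
  apply/measurable_EFinP/measurable_funX.
  exact: (sub_measurable_fun (subK t0)) aZX.
under eq_integral do rewrite /= ger0_norm ?sqr_ge0// exprMn.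
rewrite (ge0_integral_mul_sub (subK s0) mX2 (measurable_cst (t - s)) _ _ mZ2)//.
- under eq_integral do rewrite /= mulrC EFinM.
  rewrite ge0_integralZl ?lee_fin ?subr_ge0//; first last.
  + by move=> x _; rewrite lee_fin sqr_ge0.
  + exact/measurable_EFinP/measurable_funX/(L2_measurable ZL).
  apply: lte_mul_pinfty; rewrite ?lee_fin ?subr_ge0//.
  have /integrableP[_] := Lfun2_integrable_sqr ZL.
  by under eq_integral do rewrite /= ger0_norm ?sqr_ge0//.
- by move=> x; rewrite sqr_ge0.
- by move=> x; rewrite /= subr_ge0.
- by move=> x; rewrite sqr_ge0.
- by move=> A KA; exact: normal_incr_var.
Qed.

Lemma ip_incr_eq0 X s t U V : normal_incr X -> 0 <= s -> s <= t ->
  L2_adapted s U -> L2_adapted s V -> ip P U (fun w => V w * incr X s t w) = 0.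
Proof.
move=> nX s0 st [UL mU] VS; have [VXL _] := L2_adapted_mul_incr nX s0 st VS.
case: VS => VL mV.
have E w : U w * (V w * incr X s t w) = (U w * V w) * incr X s t w by ring.
rewrite /ip; under eq_Rintegral do rewrite E.
apply: (integral_mul_sub_eq0 (subK s0)).
- exact: measurable_funM.
- have := ip_integrable (L2_cst 1) (normal_incr_L2 nX s0 st).
  by congr (integrable _ _ _); apply/funext => w /=; rewrite mul1r.
- by have := ip_integrable UL VXL; congr (integrable _ _ _); apply/funext => w /=; rewrite E.
- by move=> A KA; exact: normal_incr_mean.
Qed.

Lemma ip_incr_incr c X Y s t U V : normal_incr X -> normal_incr Y ->
  correlated_incr c X Y -> 0 <= s -> s <= t ->
  L2_adapted s U -> L2_adapted s V ->
  ip P (fun w => U w * incr X s t w) (fun w => V w * incr Y s t w) =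
  c * (t - s) * ip P U V.
Proof.
move=> nX nY cXY s0 st US VS.
have [UXL _] := L2_adapted_mul_incr nX s0 st US.
have [VYL _] := L2_adapted_mul_incr nY s0 st VS.
case: US VS => UL mU [VL mV].
have iUV := ip_integrable UL VL; have iUXVY := ip_integrable UXL VYL.
have iUVc := integrableZl measurableT (c * (t - s)) iUV.
apply/eqP; rewrite -subr_eq0 -RintegralZl// -RintegralB//.
have E w : U w * incr X s t w * (V w * incr Y s t w) - c * (t - s) * (U w * V w) =
  (U w * V w) * (incr X s t w * incr Y s t w - c * (t - s)) by ring.
under eq_Rintegral do rewrite E.
apply/eqP; apply: (integral_mul_sub_eq0 (subK s0)).
- exact: measurable_funM.
- have := integrableB measurableT
    (ip_integrable (normal_incr_L2 nX s0 st) (normal_incr_L2 nY s0 st))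
    (ip_integrable (L2_cst c) (L2_cst (t - s))).
  by [].
- have := integrableB measurableT iUXVY iUVc.
  by congr (integrable _ _ _); apply/funext => w; rewrite /= -E.
- by move=> A KA; exact: cXY.
Qed.

Definition overlap (a b c d : R) := Num.max 0 (Num.min b d - Num.max a c).

Lemma overlapC a b c d' : overlap a b c d' = overlap c d' a b.
Proof. by rewrite /overlap (minC b) (maxC a). Qed.

Let ip_overlap_le rho X Y a b c d' U V : normal_incr X -> normal_incr Y ->
  correlated_incr rho X Y -> 0 <= a -> a <= b -> a <= c -> c <= d' ->
  L2_adapted a U -> L2_adapted c V ->
  ip P (fun w => U w * incr X a b w) (fun w => V w * incr Y c d' w) =
  rho * overlap a b c d' * ip P U V.
Proof.
move=> nX nY cXY a0 ab ac cd US VS.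
have c0 := le_trans a0 ac.
rewrite /overlap (max_r ac).
have [bc|/ltW cb] := leP b c.
  rewrite (@ip_incr_eq0 Y c)//; last first.
    by apply: L2_adaptedW (L2_adapted_mul_incr nX a0 ab US); [exact: le_trans ab|].
  rewrite (_ : Num.max _ _ = 0) ?mulr0 ?mul0r//.
  by apply: max_l; rewrite subr_le0 ge_min bc.
have UcS := L2_adaptedW a0 ac US.
have UacS := L2_adapted_mul_incr nX a0 ac US.
have UcbS := L2_adapted_mul_incr nX c0 cb UcS.
have VcdS := L2_adapted_mul_incr nY c0 cd VS.
rewrite (_ : (fun w => U w * incr X a b w) =
    (fun w => U w * incr X a c w + U w * incr X c b w)); last first.
  by apply/funext => w; rewrite (incr_split X a c b) mulrDr.
rewrite ipDl ?UacS.1 ?UcbS.1 ?VcdS.1// (ip_incr_eq0 nY c0 cd UacS VS) add0r.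
have [bd|/ltW db] := leP b d'.
- rewrite max_r ?subr_ge0//.
  have VcbS := L2_adapted_mul_incr nY c0 cb VS.
  have b0 := le_trans a0 ab.
  have VbS := L2_adaptedW c0 cb VS.
  have VbdS := L2_adapted_mul_incr nY b0 bd VbS.
  rewrite (_ : (fun w => V w * incr Y c d' w) =
      (fun w => V w * incr Y c b w + V w * incr Y b d' w)); last first.
    by apply/funext => w; rewrite (incr_split Y c b d') mulrDr.
  rewrite ipDr ?UcbS.1 ?VcbS.1 ?VbdS.1// (ip_incr_eq0 nY b0 bd UcbS VbS) addr0.
  exact: ip_incr_incr.
- rewrite max_r ?subr_ge0//.
  have d0 := le_trans c0 cd.
  have UcdS := L2_adapted_mul_incr nX c0 cd UcS.
  have UdS := L2_adaptedW c0 cd UcS.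
  have UdbS := L2_adapted_mul_incr nX d0 db UdS.
  rewrite (_ : (fun w => U w * incr X c b w) =
      (fun w => U w * incr X c d' w + U w * incr X d' b w)); last first.
    by apply/funext => w; rewrite (incr_split X c d' b) mulrDr.
  rewrite ipDl ?UcdS.1 ?UdbS.1 ?VcdS.1// [X in _ + X]ipC.
  rewrite (ip_incr_eq0 nX d0 db VcdS UdS) addr0.
  exact: ip_incr_incr.
Qed.

(* Splitting each interval at the endpoints of the other, every piece but the
   common one lies after the rest of the product and integrates to 0. *)
Lemma ip_overlap rho X Y a b c d' U V : normal_incr X -> normal_incr Y ->
  correlated_incr rho X Y -> 0 <= a -> a <= b -> 0 <= c -> c <= d' ->
  L2_adapted a U -> L2_adapted c V ->
  ip P (fun w => U w * incr X a b w) (fun w => V w * incr Y c d' w) =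
  rho * overlap a b c d' * ip P U V.
Proof.
move=> nX nY cXY a0 ab c0 cd US VS; have [ac|/ltW ca] := leP a c.
  exact: ip_overlap_le.
rewrite ipC overlapC (ipC P U); apply: ip_overlap_le => //.
exact: correlated_incrC.
Qed.

Definition incr_prod (X : R -> T -> R) (a b : nat -> R) n w : R :=
  \prod_(i < n) incr X (a i) (b i) w.

Definition ordered_intervals (a b : nat -> R) n : Prop :=
  (forall i, (i < n)%N -> 0 <= a i <= b i) /\
  (forall i j, (i < j < n)%N -> b i <= a j).

Lemma ordered_intervalsS a b n :
  ordered_intervals a b n.+1 -> ordered_intervals a b n.
Proof.
move=> [ab ba]; split => [i /ltnW|i j /andP[ij jn]]; first exact: ab.
by apply: ba; rewrite ij ltnW.
Qed.

Lemma incr_prodS X a b n :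
  incr_prod X a b n.+1 = (fun w => incr_prod X a b n w * incr X (a n) (b n) w).
Proof. by apply/funext => w; rewrite /incr_prod big_ord_recr. Qed.

Lemma incr_prod0 X a b : incr_prod X a b 0 = cst 1.
Proof. by apply/funext => w; rewrite /incr_prod big_ord0. Qed.

Lemma incr_prod_adapted X a b n t : normal_incr X -> ordered_intervals a b n ->
  0 <= t -> (forall i, (i < n)%N -> b i <= t) -> L2_adapted t (incr_prod X a b n).
Proof.
move=> nX; elim: n t => [|n IH] t oab t0 bt.
  by rewrite incr_prod0; exact: L2_adapted_cst.
have [ab ba] := oab; have /andP[an0 abn] := ab n (ltnSn n).
rewrite incr_prodS.
apply: (@L2_adaptedW (b n)); [exact: le_trans abn|exact: bt|].
apply: L2_adapted_mul_incr => //; apply: IH => //; first exact: ordered_intervalsS.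
by move=> i ilt; apply: ba; rewrite ilt leqnn.
Qed.

Lemma incr_prod_L2 X a b n : normal_incr X -> ordered_intervals a b n ->
  incr_prod X a b n \in L2.
Proof.
move=> nX oab; pose t := \big[Num.max/0]_(i < n) b i.
have t0 : 0 <= t by rewrite /t; exact: bigmax_ge_id.
suff : L2_adapted t (incr_prod X a b n) by case.
apply: incr_prod_adapted => // i ilt.
by rewrite /t; exact: (le_bigmax _ (fun i : 'I_n => b i) (Ordinal ilt)).
Qed.

Lemma ip_incr_prod_last_eq0 X Y a b n c d' : normal_incr X -> normal_incr Y ->
  ordered_intervals a b n.+1 ->
  ip P (incr_prod X a b n.+1) (incr_prod Y c d' 0) = 0.
Proof.
move=> nX nY oab; have [ab ba] := oab; have /andP[an0 abn] := ab n (ltnSn n).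
rewrite incr_prodS incr_prod0 ipC; apply: ip_incr_eq0 => //.
  exact: L2_adapted_cst.
apply: incr_prod_adapted => //; first exact: ordered_intervalsS.
by move=> i ilt; apply: ba; rewrite ilt leqnn.
Qed.

Lemma ip_incr_prod rho X Y a b n c d' m : normal_incr X -> normal_incr Y ->
  correlated_incr rho X Y ->
  ordered_intervals a b n -> ordered_intervals c d' m ->
  ip P (incr_prod X a b n) (incr_prod Y c d' m) =
  (n == m)%:R * rho ^+ n * \prod_(i < n) overlap (a i) (b i) (c i) (d' i).
Proof.
move=> nX nY cXY; elim: n m => [|n IH] [|m] oab ocd.
- rewrite !incr_prod0 big_ord0 eqxx expr0 !mulr1 /ip.
  transitivity (\int[P]_w (cst 1 w : R)).
    by apply: eq_Rintegral => w _; rewrite /= mulr1.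
  by rewrite Rintegral_cst// PT mulr1.
- by rewrite ipC ip_incr_prod_last_eq0// !mul0r.
- by rewrite ip_incr_prod_last_eq0// !mul0r.
have [ab ba] := oab; have /andP[an0 abn] := ab n (ltnSn n).
have [cd dc] := ocd; have /andP[cm0 cdm] := cd m (ltnSn m).
have oab' := ordered_intervalsS oab; have ocd' := ordered_intervalsS ocd.
rewrite !incr_prodS (@ip_overlap rho)//; last 2 first.
- by apply: incr_prod_adapted => // i ilt; apply: ba; rewrite ilt leqnn.
- by apply: incr_prod_adapted => // i ilt; apply: dc; rewrite ilt leqnn.
rewrite IH// eqSS; have [->|] := eqVneq n m; last by rewrite !mul0r mulr0.
by rewrite big_ord_recr/= exprS; ring.
Qed.

End normal_increments.

(** * Lebesgue measure on tuples *)

Section lebesgue_tuple.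
Context (R : realType).

Definition rect n (V : 'I_n -> set R) : set (n.-tuple R) :=
  [set x | forall i, V i (tnth x i)].

Lemma rect_bigcap n (V : 'I_n -> set R) :
  rect V = \bigcap_(i in setT) (fun x => tnth x i) @^-1` V i.
Proof. by apply/seteqP; split => x /= xV i; [move=> _|]; exact: xV. Qed.

Lemma measurable_rect n (V : 'I_n -> set R) :
  (forall i, measurable (V i)) -> measurable (rect V).
Proof.
move=> mV; rewrite rect_bigcap; apply: fin_bigcap_measurable => // i _.
rewrite -[X in measurable X]setTI; exact: measurable_tnth.
Qed.

Lemma lebesgue_tupleS n (A : set (n.+1.-tuple R)) :
  lebesgue_tuple R n.+1 A =
  (lebesgue_tuple R n \x lebesgue_measure)%E (@tuple_cons R n @^-1` A).
Proof. by []. Qed.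

Lemma tnth_tuple_consS n (p : n.-tuple R * R) i :
  tnth (tuple_cons p) (lift ord0 i) = tnth p.1 i.
Proof. by rewrite tnthS. Qed.

Lemma lebesgue_tuple_rect n (V : 'I_n -> set R) :
  (forall i, measurable (V i)) ->
  (lebesgue_tuple R n (rect V) = \prod_(i < n) lebesgue_measure (V i))%E.
Proof.
elim: n V => [V _|n IH V mV].
  rewrite big_ord0 /= diracE mem_set//= => i; by case: i.
rewrite lebesgue_tupleS big_ord_recl.
have -> : @tuple_cons R n @^-1` rect V =
    rect (fun i => V (lift ord0 i)) `*` V ord0.
  apply/seteqP; split => [p pV|p [pV p0] i].
    split; last exact: (pV ord0).
    by move=> i; have := pV (lift ord0 i); rewrite tnth_tuple_consS.
  case: (unliftP ord0 i) => [j|] ->; last exact: p0.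
  by rewrite tnth_tuple_consS; exact: pV.
rewrite product_measure1E; [|by apply: measurable_rect|exact: mV].
by rewrite muleC IH.
Qed.

Lemma measurable_rects n : @measurable _ (n.-tuple R) =
  <<s [set A | exists2 V : 'I_n -> set R, (forall i, measurable (V i)) & A = rect V] >>.
Proof.
rewrite eqEsubset; split; last first.
  apply: smallest_sub; first exact: sigma_algebra_measurable.
  by move=> _ [V mV ->]; exact: measurable_rect.
apply: smallest_sub; first exact: smallest_sigma_algebra.
move=> A; rewrite -bigcup_seq => -[i _ [B mB <-]]; apply: sub_sigma_algebra.
exists (fun j => if j == i then B else setT) => [j|]; first by case: ifP.
apply/seteqP; split => [x [_ xB] j|x xB].
  by case: ifPn => // /eqP ->.
by split => //; have := xB i; rewrite eqxx.
Qed.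

Lemma lebesgue_tuple_unique n (m : {measure set (n.-tuple R) -> \bar R}) :
  (forall V : 'I_n -> set R, (forall i, measurable (V i)) ->
    m (rect V) = \prod_(i < n) lebesgue_measure (V i))%E ->
  forall A, measurable A -> m A = lebesgue_tuple R n A.
Proof.
move=> mE; pose V_ k := `[- k%:R, k%:R]%classic : set R.
pose g k := rect (fun _ : 'I_n => V_ k).
apply: (measure_unique
  [set A | exists2 V : 'I_n -> set R, (forall i, measurable (V i)) & A = rect V] g).
- exact: measurable_rects.
- move=> _ _ [V mV ->] [W mW ->]; exists (fun i => V i `&` W i).
    by move=> i; exact: measurableI.
  by apply/seteqP; split => [x [xV xW] i|x xVW]; split => // i; case: (xVW i).
- by move=> k; exists (fun=> V_ k) => // _; exact: measurable_itv.
- apply/seteqP; split => // x _.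
  pose M := \big[Num.max/0]_(i < n) `|tnth x i|.
  exists (Num.truncn M).+1 => //= i; rewrite /V_ set_itvcc/= -ler_norml.
  apply: (@le_trans _ _ M); first exact: (le_bigmax _ (fun i => `|tnth x i|) i).
  exact: ltW (truncnS_gt _).
- by move=> _ [V mV ->]; rewrite mE// lebesgue_tuple_rect.
- move=> k; have [r rE] : exists r, lebesgue_measure (V_ k) = r%:E.
    by rewrite /V_ lebesgue_measure_itv/=; case: ifP => _; rewrite -?EFinB; eexists.
  rewrite mE => [|_]; last exact: measurable_itv.
  by under eq_bigr do rewrite rE; rewrite prodEFin ltry.
Qed.

Definition permute_tuple n (s : {perm 'I_n}) (x : n.-tuple R) : n.-tuple R :=
  [tuple tnth x (s i) | i < n].

Lemma measurable_permute_tuple n (s : {perm 'I_n}) :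
  measurable_fun setT (permute_tuple s).
Proof.
apply/measurable_fun_tnthP => i; have := @measurable_tnth _ R n (s i).
by congr measurable_fun; apply/funext => x; rewrite /= tnth_mktuple.
Qed.

Lemma integral_permute_tuple n (s : {perm 'I_n}) (g : n.-tuple R -> \bar R) :
  measurable_fun setT g -> (forall x, 0 <= g x)%E ->
  (\int[lebesgue_tuple R n]_x g (permute_tuple s x) =
   \int[lebesgue_tuple R n]_x g x)%E.
Proof.
move=> mg g0.
have := ge0_integral_pushforward (@measurable_permute_tuple n s)
  (lebesgue_tuple R n) measurableT mg (fun y _ => g0 y).
rewrite preimage_setT => <-.
pose m := measure_function_pushforward__canonical__measure_function_Measure
   (lebesgue_tuple R n) (@measurable_permute_tuple n s).
apply: (@eq_measure_integral _ _ _ setT _ m) => A mA _.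
apply: (lebesgue_tuple_unique (m := m)) => // V mV.
rewrite [LHS]/=/pushforward.
have -> : permute_tuple s @^-1` rect V = rect (fun i => V ((s^-1)%g i)).
  apply/seteqP; split => x /= xV i.
    by have := xV ((s^-1)%g i); rewrite tnth_mktuple permKV.
  by have := xV (s i); rewrite tnth_mktuple permK.
rewrite lebesgue_tuple_rect//.
by rewrite [RHS](reindex_inj (@perm_inj _ (s^-1)%g)).
Qed.

Lemma measurable_tnth_rel n (i j : 'I_n) :
  measurable [set x : n.-tuple R | tnth x i = tnth x j].
Proof.
have := measurable_funB (@measurable_tnth _ R n i) (@measurable_tnth _ R n j).
move=> /(_ measurableT [set 0] (measurable_set1 0)); rewrite setTI.
congr measurable; apply/seteqP; split => x /= => [/eqP|->]; last exact: subrr.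
by rewrite subr_eq0 => /eqP.
Qed.

Lemma lebesgue_tuple_diag n (i j : 'I_n) : i != j ->
  lebesgue_tuple R n [set x | tnth x i = tnth x j] = 0%E.
Proof.
have diag0 m (k : 'I_m) :
    lebesgue_tuple R m.+1 [set x | tnth x ord0 = tnth x (lift ord0 k)] = 0%E.
  rewrite lebesgue_tupleS /=/product_measure1; apply: integral0_eq => x _ /=.
  rewrite (_ : xsection _ _ = [set tnth x k]) ?lebesgue_measure_set1//.
  by apply/seteqP; split => y; rewrite /xsection /= inE /= tnth_tuple_consS.
elim: n i j => [[]//|n IH] i j.
case: (unliftP ord0 i) => [i'|] ->; case: (unliftP ord0 j) => [j'|] ->.
- move=> ij; have {}ij : i' != j' by apply: contra ij => /eqP ->.
  rewrite lebesgue_tupleS.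
  rewrite (_ : _ @^-1` _ = [set x | tnth x i' = tnth x j'] `*` setT); last first.
    apply/seteqP; split => x /=; rewrite !tnth_tuple_consS; first by [].
    by case.
  rewrite product_measure1E ?IH ?mul0e//.
  exact: measurable_tnth_rel.
- move=> _; rewrite -[RHS](diag0 n i'); congr (lebesgue_tuple _ _ _).
  by apply/seteqP; split => x.
- by move=> _; exact: diag0.
- by rewrite eqxx.
Qed.

Lemma lebesgue_tuple_coord0 n (i : 'I_n) :
  lebesgue_tuple R n [set x | tnth x i = 0] = 0%E.
Proof.
rewrite (_ : [set x | _] = rect (fun j => if j == i then [set 0] else setT)).
  rewrite lebesgue_tuple_rect => [|j]; last by case: ifP.
  by rewrite (bigD1 i)//= eqxx lebesgue_measure_set1 mul0e.
apply/seteqP; split => x; first by move=> xi j; case: ifPn => // /eqP ->.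
by move=> /(_ i); rewrite eqxx.
Qed.

Lemma measurable_open_simplex n : measurable (@open_simplex R n).
Proof.
pose lt_ (i j : 'I_n) := [set x : n.-tuple R | (i < j)%N -> tnth x i < tnth x j].
rewrite (_ : @open_simplex R n = rect (fun=> [set y | 0 < y]) `&`
   \bigcap_(i in setT) \bigcap_(j in setT) lt_ i j); last first.
  apply/seteqP; split => x [x0 xlt]; split => //; first by move=> i _ j _; exact: xlt.
  by move=> i j; exact: xlt.
apply: measurableI.
  by apply: measurable_rect => _; rewrite -set_itvoy.
apply: fin_bigcap_measurable => // i _; apply: fin_bigcap_measurable => // j _.
rewrite /lt_; have [ij|] := boolP (i < j)%N; last first.
  by move=> ij; rewrite (_ : [set x | _] = setT)//; apply/seteqP; split.
rewrite (_ : [set x | _] = [set x | tnth x i < tnth x j]); last first.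
  by apply/seteqP; split => x //=; exact.
have := measurable_fun_ltr (@measurable_tnth _ R n i) (@measurable_tnth _ R n j).
move=> /(_ measurableT [set true]); rewrite setTI; exact.
Qed.

Lemma exists_sorting_perm n (x : n.-tuple R) :
  (forall i j, i != j -> tnth x i != tnth x j) ->
  exists s : {perm 'I_n}, forall i j : 'I_n, (i < j)%N ->
    tnth (permute_tuple s x) i < tnth (permute_tuple s x) j.
Proof.
move=> xinj.
have /tuple_permP[s sE] : perm_eq (sort <=%R x) x by rewrite perm_sort.
exists s => i j ij.
have nthE k : tnth (permute_tuple s x) k = nth 0 (sort <=%R x) k.
  by rewrite (tnth_nth 0) sE.
rewrite !nthE lt_neqAle; apply/andP; split.
  rewrite -!nthE !tnth_mktuple; apply: xinj.
  by rewrite (inj_eq perm_inj); apply: contraTneq ij => ->; rewrite ltnn.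
apply: sorted_leq_nth (ltnW ij); rewrite ?inE ?size_sort ?size_tuple//.
- exact: le_trans.
- exact: sort_sorted le_total _.
Qed.

Lemma simplex_restrictE n (f : n.-tuple R -> R) :
  f \_ (@open_simplex R n) =
  (fun x => \1_(@open_simplex R n) x * (f \_ (@orthant R n)) x).
Proof.
apply/funext => x; rewrite !patchE indicE.
have [xs|_] := boolP (x \in open_simplex (n:=n)); last by rewrite mul0r.
by rewrite mul1r mem_set// => i; have [x0 _] := set_mem xs; exact: ltW.
Qed.

Lemma simplex_restrict_L2 n (f : n.-tuple R -> R) : symmetric_L2_kernel f ->
  f \_ (@open_simplex R n) \in Lfun (lebesgue_tuple R n) 2%:E.
Proof.
case=> foL _; rewrite simplex_restrictE; set fs := (fun _ => _).
have mfs : measurable_fun setT fs.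
  apply: measurable_funM; last exact: L2_measurable foL.
  by apply: measurable_indic; exact: measurable_open_simplex.
apply: L2_sqr_integrableP => //.
apply: le_integrable (Lfun2_integrable_sqr foL) => //.
  exact/measurable_EFinP/measurable_funX.
move=> x _; rewrite lee_fin !ger0_norm ?sqr_ge0// exprMn indicE.
by case: (_ \in _); rewrite ?expr1n ?mul1r// expr0n mul0r sqr_ge0.
Qed.

(* Up to a null set the orthant is the union of the n! images of the simplex
   under the permutations of coordinates. *)
Lemma le_kernel_norm_simplex n (f : n.-tuple R -> R) : symmetric_L2_kernel f ->
  ip (lebesgue_tuple R n) (f \_ (@orthant R n)) (f \_ (@orthant R n)) <=
  n`!%:R * ip (lebesgue_tuple R n) (f \_ (@open_simplex R n)) (f \_ (@open_simplex R n)).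
Proof.
move=> symf; have fsL := simplex_restrict_L2 symf; case: symf => foL fsym.
set lam := lebesgue_tuple R n in foL fsL *.
set fo := f \_ (@orthant R n) in foL *; set fs := f \_ (@open_simplex R n) in fsL *.
have [mfo mfs] := (L2_measurable foL, L2_measurable fsL).
have ip_int (g : n.-tuple R -> R) : g \in Lfun lam 2%:E ->
    (ip lam g g)%:E = (\int[lam]_x (g x ^+ 2)%:E)%E.
  move=> gL; rewrite /ip /Rintegral fineK.
    by apply: eq_integral => x _; rewrite expr2.
  exact: integrable_fin_num (ip_integrable gL gL).
rewrite -lee_fin EFinM !ip_int//.
have mfs2 : measurable_fun setT (fun x => (fs x ^+ 2)%:E).
  exact/measurable_EFinP/measurable_funX.
have -> : (n`!%:R%:E * \int[lam]_x (fs x ^+ 2)%:E =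
    \int[lam]_x \sum_(s : {perm 'I_n}) (fs (permute_tuple s x) ^+ 2)%:E)%E.
  rewrite ge0_integral_sum//; last 2 first.
  - move=> s; have := measurableT_comp mfs2 (@measurable_permute_tuple n s); exact.
  - by move=> s x _; rewrite lee_fin sqr_ge0.
  rewrite (eq_bigr (fun=> \int[lam]_x (fs x ^+ 2)%:E)%E) => [|s _]; last first.
    by rewrite (integral_permute_tuple s mfs2)// => x; rewrite lee_fin sqr_ge0.
  by rewrite sumr_const card_Sn mule_natl.
apply: ae_ge0_le_integral => //.
- by move=> x _; rewrite lee_fin sqr_ge0.
- exact/measurable_EFinP/measurable_funX.
- by move=> x _; rewrite sume_ge0// => s _; rewrite lee_fin sqr_ge0.
- apply: emeasurable_sum => s.
  have := measurableT_comp mfs2 (@measurable_permute_tuple n s); exact.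
have ae_inj : {ae lam, forall x, forall ij : 'I_n * 'I_n,
    ij.1 != ij.2 -> tnth x ij.1 != tnth x ij.2}.
  apply: filter_forall => -[i j] /=; have [->|ij] := eqVneq i j; first exact: aeW.
  exists [set x | tnth x i = tnth x j]; split.
  - exact: measurable_tnth_rel.
  - exact: lebesgue_tuple_diag.
  - by move=> x /= /not_implyP[_ /negP]; rewrite negbK => /eqP.
have ae_pos : {ae lam, forall x, forall i : 'I_n, tnth x i != 0}.
  apply: filter_forall => i; exists [set x | tnth x i = 0]; split.
  - have := @measurable_tnth _ R n i.
    by move=> /(_ measurableT [set 0] (measurable_set1 0)); rewrite setTI.
  - exact: lebesgue_tuple_coord0.
  - by move=> x /= /negP; rewrite negbK => /eqP.
apply: filterS2 ae_inj ae_pos => x xinj x0 _.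
have [xo|xNo] := boolP (x \in @orthant R n); last first.
  rewrite /fo patchE (negbTE xNo) expr0n/=.
  by rewrite sume_ge0// => s _; rewrite lee_fin sqr_ge0.
have [s sx] := exists_sorting_perm (fun i j => xinj (i, j)).
rewrite (bigD1 s)//= (_ : fs _ = fo x); last first.
  rewrite /fs /fo !patchE xo mem_set; first exact/fsym/set_mem.
  split; last exact: sx.
  by move=> i; rewrite tnth_mktuple lt_neqAle eq_sym x0; exact: (set_mem xo).
by rewrite leeDl// sume_ge0// => s' _; rewrite lee_fin sqr_ge0.
Qed.

End lebesgue_tuple.

(** * Step kernels and iterated integrals *)

Section step_kernels.
Context (R : realType).

Local Notation lo I := (fun i => (nth (0, 0) I i).1).
Local Notation hi I := (fun i => (nth (0, 0) I i).2).

Definition box_overlap n (I J : n.-tuple (R * R)) : R :=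
  \prod_(i < n) overlap (tnth I i).1 (tnth I i).2 (tnth J i).1 (tnth J i).2.

Lemma measurable_box n (I : n.-tuple (R * R)) : measurable (box I).
Proof.
apply: (@measurable_rect _ _ (fun i => [set y | (tnth I i).1 < y <= (tnth I i).2])).
by move=> i; rewrite -set_itvoc.
Qed.

Lemma lebesgue_tuple_boxI n (I J : n.-tuple (R * R)) :
  lebesgue_tuple R n (box I `&` box J) = (box_overlap I J)%:E.
Proof.
pose V i := `]Num.max (tnth I i).1 (tnth J i).1,
              Num.min (tnth I i).2 (tnth J i).2]%classic.
rewrite (_ : _ `&` _ = rect V); last first.
  apply/seteqP; split => x; rewrite /rect /V.
    move=> [xI xJ] i; rewrite set_itvoc/= gt_max le_min.
    by have /andP[-> ->] := xI i; have /andP[-> ->] := xJ i.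
  move=> xV; split => i; have := xV i; rewrite set_itvoc/= gt_max le_min;
  by move=> /andP[/andP[I1 J1] /andP[I2 J2]]; rewrite ?I1 ?I2 ?J1 ?J2.
rewrite lebesgue_tuple_rect => [|i]; last exact: measurable_itv.
rewrite -prodEFin; apply: eq_bigr => i _.
rewrite lebesgue_measure_itv/= lte_fin /overlap.
case: ltP => [lt|le]; rewrite -?EFinB; congr EFin; apply/esym.
  by apply: max_r; rewrite subr_ge0 ltW.
by apply: max_l; rewrite subr_le0.
Qed.

Lemma indic_box_L2 n (I : n.-tuple (R * R)) :
  (\1_(box I) : n.-tuple R -> R) \in Lfun (lebesgue_tuple R n) 2%:E.
Proof.
have mI := measurable_box I.
apply: L2_sqr_integrableP; first exact: measurable_indic.
have E x : (\1_(box I) x ^+ 2 : R) = \1_(box I) x.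
  by rewrite indicE; case: (_ \in _); rewrite ?expr1n ?expr0n.
under eq_fun do rewrite E.
apply/integrableP; split; first exact/measurable_EFinP/measurable_indic.
under eq_integral do rewrite /= ger0_norm ?indicE ?ler0n// -indicE.
by rewrite integral_indic// setIT -[box I]setIid lebesgue_tuple_boxI ltry.
Qed.

Lemma ip_indic_box n (I J : n.-tuple (R * R)) :
  ip (lebesgue_tuple R n) (\1_(box I)) (\1_(box J)) = box_overlap I J.
Proof.
rewrite /ip /Rintegral (eq_integral (fun x => (\1_(box I `&` box J) x)%:E)).
  rewrite integral_indic// ?setIT ?lebesgue_tuple_boxI//.
  by apply: measurableI; exact: measurable_box.
by move=> x _; rewrite indicI.
Qed.

Lemma step_kernel_L2 n (s : seq (R * n.-tuple (R * R))) :
  step_kernel s \in Lfun (lebesgue_tuple R n) 2%:E.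
Proof. by apply: L2_sum => c _; apply: L2Z; exact: indic_box_L2. Qed.

Lemma ip_step_kernel n (s t : seq (R * n.-tuple (R * R))) :
  ip (lebesgue_tuple R n) (step_kernel s) (step_kernel t) =
  \sum_(c <- s) \sum_(e <- t) c.1 * e.1 * box_overlap c.2 e.2.
Proof.
have bL (c : R * n.-tuple (R * R)) :
    (fun x => c.1 * \1_(box c.2) x) \in Lfun (lebesgue_tuple R n) 2%:E.
  by apply: L2Z; exact: indic_box_L2.
rewrite /step_kernel ip_suml//; last exact: step_kernel_L2.
apply: eq_bigr => c _; rewrite ip_sumr//; apply: eq_bigr => e _.
rewrite ipZl ?indic_box_L2// ipZr ?indic_box_L2// ip_indic_box.
by rewrite mulrA.
Qed.

Section integrals.
Context d (T : measurableType d).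
Variables (P : {measure set T -> \bar R}) (K : R -> set (set T)).
Hypothesis PT : P setT = 1%E.
Hypothesis subK : forall s : R, 0 <= s -> <<s K s >> `<=` measurable.
Hypothesis ndK : forall s t : R, 0 <= s -> s <= t -> <<s K s >> `<=` <<s K t >>.

Lemma ordered_box_intervals n (I : n.-tuple (R * R)) :
  ordered_box I -> ordered_intervals (lo I) (hi I) n.
Proof.
move=> [I1 I2]; split => [i ilt|i j /andP[ij jn]].
  by have := I1 (Ordinal ilt); rewrite (tnth_nth (0, 0)).
have := I2 (Ordinal (ltn_trans ij jn)) (Ordinal jn) ij.
by rewrite !(tnth_nth (0, 0)).
Qed.

Lemma incr_prod_tuple (X : R -> T -> R) n (I : n.-tuple (R * R)) w :
  \prod_(i < n) (X (tnth I i).2 w - X (tnth I i).1 w) =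
  incr_prod X (lo I) (hi I) n w.
Proof. by apply: eq_bigr => i _; rewrite !(tnth_nth (0, 0)). Qed.

Let term_L2 n X (s : seq (R * n.-tuple (R * R))) : normal_incr P K X ->
  {in s, forall c, ordered_box c.2} ->
  {in s, forall c, (fun w => c.1 *
    \prod_(i < n) (X (tnth c.2 i).2 w - X (tnth c.2 i).1 w)) \in Lfun P 2%:E}.
Proof.
move=> nX so c cs; apply: L2Z; under eq_fun do rewrite incr_prod_tuple.
apply: (incr_prod_L2 PT subK ndK) nX _.
exact/ordered_box_intervals/so.
Qed.

Lemma step_integral_L2 n X (s : seq (R * n.-tuple (R * R))) :
  normal_incr P K X -> {in s, forall c, ordered_box c.2} ->
  step_integral X s \in Lfun P 2%:E.
Proof. by move=> nX so; apply: L2_sum; exact: term_L2. Qed.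

Lemma ip_step_integral n m rho X Y (s : seq (R * n.-tuple (R * R)))
    (t : seq (R * m.-tuple (R * R))) :
  normal_incr P K X -> normal_incr P K Y -> correlated_incr P K rho X Y ->
  {in s, forall c, ordered_box c.2} -> {in t, forall c, ordered_box c.2} ->
  ip P (step_integral X s) (step_integral Y t) =
  \sum_(c <- s) \sum_(e <- t) c.1 * e.1 * ((n == m)%:R * rho ^+ n *
    \prod_(i < n) overlap (lo c.2 i) (hi c.2 i) (lo e.2 i) (hi e.2 i)).
Proof.
move=> nX nY cXY so to_.
rewrite /step_integral ip_suml//; [|exact: term_L2|exact: step_integral_L2].
rewrite big_seq [RHS]big_seq; apply: eq_bigr => c cs.
rewrite ip_sumr//; [|exact: term_L2|exact: (term_L2 nX so)].
rewrite big_seq [RHS]big_seq; apply: eq_bigr => e et.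
have oc := ordered_box_intervals (so _ cs).
have oe := ordered_box_intervals (to_ _ et).
under eq_fun do rewrite incr_prod_tuple.
under [X in ip _ _ X]eq_fun do rewrite incr_prod_tuple.
have cL := incr_prod_L2 PT subK ndK nX oc; have eL := incr_prod_L2 PT subK ndK nY oe.
rewrite ipZl//; last exact: L2Z.
by rewrite ipZr// (ip_incr_prod PT subK ndK nX nY cXY oc oe) mulrA.
Qed.

Lemma ip_iterated_integral n rho X Y (f : n.-tuple R -> R) Z W :
  normal_incr P K X -> normal_incr P K Y -> correlated_incr P K rho X Y ->
  f \_ (@open_simplex R n) \in Lfun (lebesgue_tuple R n) 2%:E ->
  iterated_integral P X f Z -> iterated_integral P Y f W ->
  ip P Z W = rho ^+ n *
    ip (lebesgue_tuple R n) (f \_ (@open_simplex R n)) (f \_ (@open_simplex R n)).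
Proof.
move=> nX nY cXY fL [ZL [s [so sf sZ]]] [WL [t [to_ tf tW]]].
have cZW := cvg_ip (fun k => step_integral_L2 nX (so k)) ZL
  (fun k => step_integral_L2 nY (to_ k)) WL sZ tW.
have cff := cvg_ip (fun k => step_kernel_L2 (s k)) fL
  (fun k => step_kernel_L2 (t k)) fL sf tf.
have E k : ip P (step_integral X (s k)) (step_integral Y (t k)) =
    rho ^+ n * ip (lebesgue_tuple R n) (step_kernel (s k)) (step_kernel (t k)).
  rewrite (ip_step_integral nX nY cXY (so k) (to_ k)) ip_step_kernel mulr_sumr.
  apply: eq_bigr => c _; rewrite mulr_sumr; apply: eq_bigr => e _.
  rewrite eqxx mul1r [RHS]mulrCA /box_overlap.
  by under [in RHS]eq_bigr do rewrite !(tnth_nth (0, 0)).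
move: cZW; rewrite (funext E) => cZW.
exact: (cvg_unique _ cZW (cvgM (cvg_cst _) cff)).
Qed.

Lemma ip_iterated_integral_eq0 n m rho X Y (f : n.-tuple R -> R)
    (g : m.-tuple R -> R) Z W :
  normal_incr P K X -> normal_incr P K Y -> correlated_incr P K rho X Y ->
  n != m ->
  iterated_integral P X f Z -> iterated_integral P Y g W -> ip P Z W = 0.
Proof.
move=> nX nY cXY nm [ZL [s [so _ sZ]]] [WL [t [to_ _ tW]]].
have cZW := cvg_ip (fun k => step_integral_L2 nX (so k)) ZL
  (fun k => step_integral_L2 nY (to_ k)) WL sZ tW.
have E k : ip P (step_integral X (s k)) (step_integral Y (t k)) = 0.
  rewrite (ip_step_integral nX nY cXY (so k) (to_ k)) (negbTE nm).
  by rewrite big1// => c _; rewrite big1// => e _; rewrite !mul0r mulr0.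
move: cZW; rewrite (funext E) => cZW.
exact: (cvg_unique _ cZW (cvg_cst _)).
Qed.

End integrals.

End step_kernels.

(** * Chaos expansions *)

Section chaos_increment.
Context d (T : measurableType d) (R : realType).
Variables (P : {measure set T -> \bar R}) (K : R -> set (set T)).
Hypothesis PT : P setT = 1%E.
Hypothesis subK : forall s : R, 0 <= s -> <<s K s >> `<=` measurable.
Hypothesis ndK : forall s t : R, 0 <= s -> s <= t -> <<s K s >> `<=` <<s K t >>.
Variable f : forall n, n.-tuple R -> R.
Hypothesis symf : forall n, symmetric_L2_kernel (f (n:=n)).

Definition simplex_ip n : R :=
  ip (lebesgue_tuple R n) (f (n:=n) \_ (@open_simplex R n))
    (f (n:=n) \_ (@open_simplex R n)).

(* The squared L^2 norm of the n-th chaos component. *)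
Definition chaos_norm2 n : R := n`!%:R ^+ 2 * simplex_ip n.

Lemma chaos_norm2_ge0 n : 0 <= chaos_norm2 n.
Proof. by rewrite mulr_ge0 ?sqr_ge0// ip_ge0. Qed.

Lemma correlated_incr_self X : normal_incr P K X -> correlated_incr P K 1 X X.
Proof.
move=> nX s t A s0 st KA; have mA := subK s0 KA.
have XL := normal_incr_L2 nX s0 st.
have iX := integrableS measurableT mA (subsetT _) (Lfun2_integrable_sqr XL).
have ic : P.-integrable A (EFin \o cst (t - s)).
  apply: (integrableS measurableT) => //.
  have := ip_integrable (L2_cst PT 1) (L2_cst PT (t - s)).
  by congr (integrable _ _ _); apply/funext => w /=; rewrite mul1r.
transitivity (\int[P]_(w in A) ((incr X s t w ^+ 2)%:E - (t - s)%:E))%E.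
  by apply: eq_integral => w _; rewrite -EFinB mul1r expr2.
rewrite integralB// (normal_incr_var nX)// subee//.
exact: integrable_fin_num ic.
Qed.

Lemma ip_multiple_integral n m rho X Y A B :
  normal_incr P K X -> normal_incr P K Y -> correlated_incr P K rho X Y ->
  multiple_integral P X (f (n:=n)) A -> multiple_integral P Y (f (n:=m)) B ->
  ip P A B = (n == m)%:R * (rho ^+ n * chaos_norm2 n).
Proof.
move=> nX nY cXY [Z iZ ->] [W iW ->].
have [ZL WL] := (iZ.1, iW.1).
rewrite ipZl ?L2Z// ipZr//; have [nm|nm] := eqVneq n m; last first.
  by rewrite (ip_iterated_integral_eq0 PT subK ndK nX nY cXY nm iZ iW) !mulr0 mul0r.
case: m / nm iW => iW.
rewrite (ip_iterated_integral PT subK ndK nX nY cXY _ iZ iW); last first.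
  exact: simplex_restrict_L2.
by rewrite mul1r /chaos_norm2 /simplex_ip; ring.
Qed.

Lemma multiple_integral_L2 n X A :
  multiple_integral P X (f (n:=n)) A -> A \in Lfun P 2%:E.
Proof. by move=> [Z [ZL _] ->]; exact: L2Z. Qed.

Lemma cvg_ip_chaos rho X Y FX FY :
  normal_incr P K X -> normal_incr P K Y -> correlated_incr P K rho X Y ->
  chaos_sum P X f FX -> chaos_sum P Y f FY ->
  (fun N => \sum_(n < N) rho ^+ n * chaos_norm2 n) @ \oo --> ip P FX FY.
Proof.
move=> nX nY cXY [FXL [A iA sA]] [FYL [B iB sB]].
have AL n := multiple_integral_L2 (iA n); have BL n := multiple_integral_L2 (iB n).
have SAL N : (fun w => \sum_(n < N) A n w) \in Lfun P 2%:E.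
  by apply: L2_sum => n _; exact: AL.
have SBL N : (fun w => \sum_(n < N) B n w) \in Lfun P 2%:E.
  by apply: L2_sum => n _; exact: BL.
pose S N := ip P (fun w => \sum_(n < N) A n w) (fun w => \sum_(n < N) B n w).
rewrite (_ : (fun N => _) = S); first exact: cvg_ip.
apply/esym/funext => N; rewrite /S ip_suml//; apply: eq_bigr => n _.
rewrite ip_sumr// (bigD1 n)//= (ip_multiple_integral nX nY cXY (iA n) (iB n)).
rewrite eqxx mul1r big1 ?addr0// => m mn.
rewrite (ip_multiple_integral nX nY cXY (iA n) (iB m)) eq_sym.
by rewrite (_ : (m == n :> nat) = false) ?mul0r//; exact: negbTE mn.
Qed.

Lemma chaos_increment_ge rho X Y FX FY N :
  normal_incr P K X -> normal_incr P K Y -> correlated_incr P K rho X Y ->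
  `|rho| <= 1 -> chaos_sum P X f FX -> chaos_sum P Y f FY ->
  \sum_(n < N) 2 * (1 - rho ^+ n) * chaos_norm2 n <=
  ip P (fun w => FX w - FY w) (fun w => FX w - FY w).
Proof.
move=> nX nY cXY rho1 sX sY.
have cXX := cvg_ip_chaos nX nX (correlated_incr_self nX) sX sX.
have cYY := cvg_ip_chaos nY nY (correlated_incr_self nY) sY sY.
have cXY_ := cvg_ip_chaos nX nY cXY sX sY.
have [FXL FYL] := (sX.1, sY.1).
pose u N := \sum_(n < N) 2 * (1 - rho ^+ n) * chaos_norm2 n.
have cu : u @ \oo --> ip P (fun w => FX w - FY w) (fun w => FX w - FY w).
  rewrite ipBl ?ipBr ?L2B// (ipC P FY FX).
  pose S r k := \sum_(n < k) r ^+ n * chaos_norm2 n.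
  rewrite (_ : u = (fun k => (S 1 k - S rho k) - (S rho k - S 1 k))).
    exact: cvgB (cvgB cXX cXY_) (cvgB cXY_ cYY).
  apply/funext => k; rewrite /u /S -!sumrB; apply: eq_bigr => n _.
  by rewrite expr1n; ring.
have ndu : nondecreasing_seq u.
  apply/nondecreasing_seqP => k; rewrite /u big_ord_recr lerDl.
  rewrite mulr_ge0 ?chaos_norm2_ge0// mulr_ge0// subr_ge0.
  by rewrite (le_trans (ler_norm _))// normrX exprn_ile1.
have -> : ip P (fun w => FX w - FY w) (fun w => FX w - FY w) = limn u.
  exact/esym/cvg_lim.
apply: nondecreasing_cvgn_le => //.
by apply/cvg_ex; eexists; exact: cu.
Qed.

End chaos_increment.

(** * Moments of the normal distribution *)

Section normal_moments.
Context (R : realType).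
Local Notation lam := (@lebesgue_measure R).

Import HBNNSimple.

Lemma ge0_integral_density d (T : measurableType d)
    (mu nu : {measure set T -> \bar R}) (f Z : T -> R) :
  measurable_fun setT f -> (forall x, 0 <= f x) ->
  measurable_fun setT Z -> (forall x, 0 <= Z x) ->
  (forall A, measurable A -> nu A = \int[mu]_(x in A) (f x)%:E)%E ->
  (\int[nu]_x (Z x)%:E = \int[mu]_x (Z x * f x)%:E)%E.
Proof.
move=> mf f0 mZ Z0 nuf.
have mZE : measurable_fun setT (EFin \o Z) by exact/measurable_EFinP.
pose h := nnsfun_approx measurableT mZE.
have hZ x : EFin (h n x) @[n --> \oo] --> (Z x)%:E.
  by apply: cvg_nnsfun_approx => // y _; rewrite lee_fin.
have ndh x : {homo (fun n => h n x) : n m / (n <= m)%N >-> n <= m}.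
  by move=> a b ab; have /lefP/(_ x) := nd_nnsfun_approx measurableT mZE ab.
have -> : (\int[nu]_x (Z x)%:E = limn (fun n => \int[nu]_x (h n x)%:E))%E.
  rewrite -monotone_convergence//.
  - by apply: eq_integral => x _; apply/esym/cvg_lim => //; exact: hZ.
  - by move=> n; exact/measurable_EFinP.
  - by move=> n x _; rewrite lee_fin.
  - by move=> x _ a b ab; rewrite lee_fin; exact: ndh.
have -> : (\int[mu]_x (Z x * f x)%:E = limn (fun n => \int[mu]_x (h n x * f x)%:E))%E.
  rewrite -monotone_convergence//.
  - apply: eq_integral => x _; apply/esym/cvg_lim => //.
    under eq_fun do rewrite EFinM.
    by rewrite EFinM; apply: cvgeZr => //; exact: hZ.
  - by move=> n; apply/measurable_EFinP; exact: measurable_funM.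
  - by move=> n x _; rewrite lee_fin mulr_ge0.
  - by move=> x _ a b ab; rewrite lee_fin ler_wpM2r//; exact: ndh.
congr (limn _); apply/funext => n.
have mhr r : measurable (h n @^-1` [set r]) by exact: measurable_funPTI.
have fimE := ge0_integral_mul_fimfun _ (fun x => fun_ge0 x) mhr.
rewrite (eq_integral (fun x => (h n x * cst 1 x)%:E)) ?fimE//; last first.
  by move=> x _; rewrite mulr1.
apply: eq_fsbigr => r _; congr (_ * _)%E.
by rewrite -nuf// (integral_cst nu (mhr r) 1) mul1e.
Qed.

Variable sigma : R.
Hypothesis sigma_gt0 : 0 < sigma.
Local Notation phi := (normal_pdf 0 sigma).

Let sigma_neq0 : sigma != 0. Proof. by rewrite gt_eqF. Qed.

Let phiE : phi = (fun x => normal_peak sigma * expR (- (x ^+ 2 / (sigma ^+ 2 * 2)))).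
Proof.
rewrite (normal_pdfE _ sigma_neq0); apply/funext => x.
by rewrite /normal_fun subr0 mulNr mulr_natr.
Qed.

Lemma normal_pdf0_even x : phi (- x) = phi x.
Proof. by rewrite phiE sqrrN. Qed.

Lemma is_derive_normal_pdf (x : R) :
  is_derive x (1 : R) (fun y : R => - (sigma ^+ 2 * phi y) : R) (x * phi x).
Proof.
rewrite phiE; apply: is_derive_eq.
set e := expR _; rewrite /GRing.scale/=.
by field.
Qed.

Lemma cvg_normal_pdf : phi x @[x --> +oo] --> (0 : R).
Proof.
rewrite phiE -[X in _ --> X](mulr0 (normal_peak sigma)); apply: cvgM; first exact: cvg_cst.
pose c := (Num.sqrt (sigma ^+ 2 * 2))^-1.
have c0 : 0 < c by rewrite invr_gt0 sqrtr_gt0 mulr_gt0// exprn_gt0.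
rewrite (_ : (fun x => _) = (fun x => gauss_fun (x * c))); last first.
  apply/funext => x; rewrite /gauss_fun exprMn exprVn sqr_sqrtr//.
  by rewrite mulr_ge0// sqr_ge0.
apply: (cvg_comp _ _ _ (@cvg_gauss_fun R)).
apply: gt0_cvgMly => //; exact: cvg_id.
Qed.

Lemma integral_tail_id_normal (y : R) : 0 <= y ->
  (\int[lam]_(x in `[y, +oo[) (x * phi x)%:E = (sigma ^+ 2 * phi y)%:E)%E.
Proof.
move=> y0; pose F x := - (sigma ^+ 2 * phi x).
have dF (x : R) := is_derive_normal_pdf x.
have cphi := @continuous_normal_pdf R 0 sigma sigma_neq0.
have cF : continuous F.
  by move=> x; apply: cvgN; apply: cvgM; [exact: cvg_cst|exact: cphi].
rewrite (@ge0_continuous_FTC2y _ _ F y 0).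
- by rewrite /F sub0e -EFinN opprK.
- move=> x yx; rewrite mulr_ge0 ?normal_pdf_ge0//.
  exact: le_trans yx.
- apply: continuous_subspaceT => x; apply: cvgM; [exact: cvg_id|exact: cphi].
- rewrite -oppr0 -(mulr0 (sigma ^+ 2)); apply: cvgN; apply: cvgM.
    exact: cvg_cst.
  exact: cvg_normal_pdf.
- by move=> x _; have [] := dF x.
- exact: cvg_at_right_filter (cF y).
- by move=> x _; rewrite derive1E; have [_] := dF x.
Qed.

Let mphi : measurable_fun setT phi. Proof. exact: measurable_normal_pdf. Qed.

Let phi_ge0 x : 0 <= phi x. Proof. exact: normal_pdf_ge0. Qed.

(* Writing the first factor of [x * (x * phi x)] as the length of [0, x] and
   exchanging the integrals leaves the tail integrals of [x * phi x]. *)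
Lemma integral_half_sqr_normal :
  (\int[lam]_(x in [set x | (0 <= x)%R]) (x ^+ 2 * phi x)%:E =
   (sigma ^+ 2)%:E * \int[lam]_(x in [set x | (0 <= x)%R]) (phi x)%:E)%E.
Proof.
pose D := [set z : R * R | 0 <= z.2 <= z.1].
have mD : measurable D.
  have m1 : measurable [set z : R * R | 0 <= z.2].
    have := @measurable_snd _ _ R R; move/(_ measurableT `[0, +oo[%classic).
    rewrite setTI => /(_ (measurable_itv _)).
    by congr measurable; apply/seteqP; split => z /=; rewrite in_itv/= andbT.
  have m2 : measurable [set z : R * R | z.2 <= z.1].
    have := measurable_fun_ler (@measurable_snd _ _ R R) (@measurable_fst _ _ R R).
    by move=> /(_ measurableT [set true]); rewrite setTI; exact.
  rewrite (_ : D = [set z | 0 <= z.2] `&` [set z | z.2 <= z.1]).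
    exact: measurableI.
  by apply/seteqP; split => [z /andP[z0 zz]|z [z0 zz]] //; exact/andP.
pose h (z : R * R) := ((z.1 * phi z.1) * \1_D z)%:E.
have h0 z : (0 <= h z)%E.
  rewrite lee_fin indicE; have [/set_mem/andP[z0 zz]|_] := boolP (z \in D).
    by rewrite mulr1 mulr_ge0// (le_trans z0).
  by rewrite mulr0.
have mh : measurable_fun setT h.
  apply/measurable_EFinP; apply: measurable_funM; last exact: measurable_indic.
  apply: measurable_funM => //.
  exact: measurableT_comp mphi _.
have := @fubini_tonelli _ _ _ _ _ lam lam h mh h0.
have -> : (\int[lam]_x \int[lam]_y h (x, y) =
    \int[lam]_(x in [set x | (0 <= x)%R]) (x ^+ 2 * phi x)%:E)%E.
  rewrite [RHS]integral_mkcond; apply: eq_integral => x _.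
  rewrite patchE; have [/set_mem/= x0|/negP xN] := boolP (x \in _); last first.
    apply: integral0_eq => y _; rewrite /h indicE memNset ?mulr0// => /andP[y0 yx].
    by apply: xN; apply/mem_set; exact: le_trans yx.
  have hE y : h (x, y) = ((x * phi x)%:E * (\1_`[0%R, x]%classic y)%:E)%E.
    rewrite /h -EFinM !indicE.
    have -> : ((x, y) \in D) = (y \in `[0%R, x]%classic).
      by apply/idP/idP => /set_mem yx; apply/mem_set; move: yx; rewrite /D /= in_itv.
    by [].
  under eq_integral do rewrite hE.
  have xphi0 : 0 <= x * phi x by rewrite mulr_ge0.
  rewrite ge0_integralZl//; last exact/measurable_EFinP/measurable_indic.
  rewrite integral_indic//= setIT lebesgue_measure_itv/= lte_fin oppr0 adde0.
  case: ltgtP x0 => // [x0 _|<- _]; last by rewrite mule0 expr0n mul0r.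
  by rewrite -EFinM; congr EFin; ring.
move=> ->.
rewrite -ge0_integralZl//; last first.
- by rewrite lee_fin sqr_ge0.
- by move=> x _; rewrite lee_fin.
- exact/measurable_EFinP/measurable_funTS.
- by rewrite -set_itvcy.
rewrite [RHS]integral_mkcond; apply: eq_integral => y _.
rewrite patchE; have [/set_mem y0|yN] := boolP (y \in _).
  rewrite -EFinM -integral_tail_id_normal// [RHS]integral_mkcond.
  apply: eq_integral => x _; rewrite /h patchE indicE.
  rewrite (_ : ((x, y) \in D) = (x \in `[y, +oo[%classic)).
    by case: ifP => _; rewrite ?mulr1 ?mulr0.
  by apply/idP/idP => /set_mem xy; apply/mem_set; move: xy;
    rewrite /D /= in_itv/= ?andbT y0.
rewrite integral0_eq// => x _; rewrite /h indicE memNset ?mulr0// => /andP[y0 _].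
by move: yN; rewrite mem_set.
Qed.

Lemma integral_sqr_normal : (\int[lam]_x (x ^+ 2 * phi x)%:E = (sigma ^+ 2)%:E)%E.
Proof.
have cphi := @continuous_normal_pdf R 0 sigma sigma_neq0.
rewrite ge0_symfun_integralT; first last.
- by move=> x /=; rewrite sqrrN normal_pdf0_even.
- move=> x; apply: cvgM; last exact: cphi.
  exact: exprn_continuous.
- by move=> x; rewrite mulr_ge0 ?sqr_ge0.
rewrite integral_half_sqr_normal muleCA -ge0_symfun_integralT//.
  by rewrite integral_normal_pdf mule1.
by move=> x /=; rewrite normal_pdf0_even.
Qed.

(* By symmetry the positive and negative parts have the same integral. *)
Lemma integral_id_normal : (\int[lam]_x (x * phi x)%:E = 0)%E.
Proof.
have cphi := @continuous_normal_pdf R 0 sigma sigma_neq0.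
pose E := (fun x : R => (x * phi x)%:E).
have cE : continuous (fun x : R => x * phi x).
  by move=> x; apply: cvgM; [exact: cvg_id|exact: cphi].
have mE : measurable_fun setT E.
  by apply/measurable_EFinP; exact: continuous_measurable_fun.
rewrite -[LHS]/(\int[lam]_x E x)%E integralE.
have pos : (\int[lam]_x E^\+ x = \int[lam]_(x in `[0%R, +oo[) (x * phi x)%:E)%E.
  rewrite [RHS]integral_mkcond; apply: eq_integral => x _.
  rewrite patchE funeposE /E; case: ifPn => [/set_mem/=|/negP xN].
    rewrite in_itv/= andbT => x0; apply/max_idPl.
    by rewrite lee_fin mulr_ge0.
  apply/max_idPr; rewrite lee_fin mulr_le0_ge0// leNgt; apply/negP => x0.
  by apply: xN; apply/mem_set; rewrite /= in_itv/= ltW.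
have neg : (\int[lam]_x E^\- x = \int[lam]_(x in `[0%R, +oo[) (x * phi x)%:E)%E.
  transitivity (\int[lam]_(x in `]-oo, (- 0)%R]) (- (x * phi x))%:E)%E.
    rewrite [RHS]integral_mkcond; apply: eq_integral => x _.
    rewrite patchE funenegE /E; case: ifPn => [/set_mem/=|/negP xN].
      rewrite in_itv/= oppr0 => x0; apply/max_idPl.
      by rewrite lee_fin oppr_ge0 mulr_le0_ge0.
    apply/max_idPr; rewrite -EFinN lee_fin oppr_le0 mulr_ge0// leNgt; apply/negP => x0.
    by apply: xN; apply/mem_set; rewrite /= in_itv/= oppr0 ltW.
  rewrite ge0_integration_by_substitutionNy.
  - by apply: eq_integral => x _; rewrite /= normal_pdf0_even mulNr opprK.
  - by apply: continuous_subspaceT => x; apply: cvgN; exact: cE.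
  - move=> x; rewrite in_itv/= oppr0 => x0.
    by rewrite oppr_ge0 mulr_le0_ge0// ltW.
by rewrite pos neg integral_tail_id_normal// subee.
Qed.

End normal_moments.

(** * Conditionally centered variables and Brownian motion *)

Section centered.
Context d (T : measurableType d) (R : realType).
Variable P : {measure set T -> \bar R}.
Implicit Types (K : set (set T)) (g Z : T -> R).

(* For a finite measure this says that the conditional expectation of [g]
   given [<<s K >>] vanishes. *)
Definition centered K g : Prop :=
  P.-integrable setT (EFin \o g) /\
  forall A, <<s K >> A -> (\int[P]_(x in A) (g x)%:E = 0)%E.

Lemma eq_centered K g h : g =1 h -> centered K g -> centered K h.
Proof. by move=> /funext ->. Qed.

Lemma centeredD K g h : <<s K >> `<=` measurable -> centered K g ->
  centered K h -> centered K (fun x => g x + h x).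
Proof.
move=> subK [ig g0] [ih h0]; split.
  by have := integrableD measurableT ig ih; exact.
move=> A KA; have mA := subK _ KA.
under eq_integral do rewrite EFinD.
by rewrite integralD_EFin ?g0 ?h0 ?adde0//; exact: integrableS (subsetT _) _.
Qed.

Lemma centeredZ K g a : <<s K >> `<=` measurable -> centered K g ->
  centered K (fun x => a * g x).
Proof.
move=> subK [ig g0]; split.
  by have := integrableZl measurableT a ig; exact.
move=> A KA; have mA := subK _ KA.
under eq_integral do rewrite EFinM.
rewrite integralZl ?g0 ?mule0//; exact: integrableS (subsetT _) _.
Qed.

Lemma integral_indicl (A : set T) g : measurable A ->
  (\int[P]_(x in A) (g x)%:E = \int[P]_x (\1_A x * g x)%:E)%E.
Proof.
move=> mA; rewrite integral_mkcond; apply: eq_integral => x _.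
by rewrite epatch_indic /= -EFinM mulrC.
Qed.

Lemma integrable_indicM (A : set T) g : measurable A ->
  P.-integrable setT (EFin \o g) ->
  P.-integrable setT (fun x => (\1_A x * g x)%:E).
Proof.
move=> mA ig.
have mg : measurable_fun setT g by apply/measurable_EFinP; exact: measurable_int ig.
apply: le_integrable ig => //.
  by apply/measurable_EFinP/measurable_funM => //; exact: measurable_indic.
move=> x _; rewrite lee_fin normrM ler_piMl// indicE.
by case: (_ \in _); rewrite ?normr1 ?normr0.
Qed.

Lemma centered_pi_system K g : <<s K >> `<=` measurable -> setI_closed K ->
  K setT -> P.-integrable setT (EFin \o g) ->
  (forall A, K A -> \int[P]_(x in A) (g x)%:E = 0)%E -> centered K g.
Proof.
move=> subK KI KT ig g0; split => // A.
pose Q (A : set T) := (\int[P]_(x in A) (g x)%:E = 0)%E.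
apply: (@dynkin_induction _ (g_sigma_algebraType K) K Q) => //.
- exact: g0.
- move=> S KS QS; have mS := subK _ KS.
  rewrite /Q integral_indicl; last exact: measurableC.
  transitivity (\int[P]_x ((g x)%:E - (\1_S x * g x)%:E))%E.
    apply: eq_integral => x _; rewrite -EFinB; congr EFin.
    by rewrite !indicE in_setC; case: (_ \in _); rewrite /=; ring.
  rewrite integralB//; last exact: integrable_indicM.
  by rewrite -integral_indicl// QS (g0 _ KT) sube0.
- move=> F mF tF QF; have mF' k := subK _ (mF k).
  rewrite /Q integral_bigcup//; last first.
    by apply: integrableS (subsetT _) ig => //; exact: bigcupT_measurable.
  by rewrite eseries0// => k _ _; exact: QF.
Qed.

Lemma centered_mul K g Z : <<s K >> `<=` measurable -> centered K g ->
  measurable_fun setT (Z : g_sigma_algebraType K -> R) ->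
  P.-integrable setT (fun x => (Z x * g x)%:E) ->
  centered K (fun x => Z x * g x).
Proof.
move=> subK [ig g0] mZ iZg; split => // A KA; have mA := subK _ KA.
have m1Z : measurable_fun setT ((fun x => \1_A x * Z x) : g_sigma_algebraType K -> R).
  by apply: measurable_funM => //; exact: measurable_indic.
have i1Zg : P.-integrable setT (fun x => (\1_A x * Z x * g x)%:E).
  by under eq_fun do rewrite -mulrA; exact: integrable_indicM.
rewrite integral_indicl//; under eq_integral do rewrite mulrA.
rewrite -[RHS]/(0%:E) -(integral_mul_sub_eq0 subK m1Z ig i1Zg g0).
by rewrite /Rintegral fineK//; exact: integrable_fin_num i1Zg.
Qed.

Lemma integral_of_centered K g a : P setT = 1%E -> <<s K >> `<=` measurable ->
  centered K (fun x => g x - a) ->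
  forall A, <<s K >> A -> (\int[P]_(x in A) (g x)%:E = \int[P]_(x in A) a%:E)%E.
Proof.
move=> PT subK [iga ga0] A KA; have mA := subK _ KA.
have ia : P.-integrable setT (EFin \o (fun=> a)).
  have := ip_integrable (L2_cst PT 1) (L2_cst PT a).
  by congr (integrable _ _ _); apply/funext => x /=; rewrite mul1r.
transitivity (\int[P]_(x in A) ((g x - a)%:E + a%:E))%E.
  by apply: eq_integral => x _; rewrite -EFinD subrK.
rewrite integralD//; try exact: integrableS (subsetT _) _.
by rewrite ga0// add0e.
Qed.

End centered.

Section brownian.
Context d (T : measurableType d) (R : realType).
Variables (P : probability T R) (B : R -> T -> R).
Hypothesis HB : brownian_motion P B.

Definition past (s : R) : set (set T) :=
  [set A | exists2 r, `[0, s]%classic r &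
    exists2 U, measurable U & A = B r @^-1` U].

Lemma sub_past s : 0 <= s -> <<s past s >> `<=` measurable.
Proof.
move=> s0; apply: smallest_sub; first exact: sigma_algebra_measurable.
move=> _ [r r0s [U mU ->]]; have [mB _ _ _] := HB.
rewrite -[X in measurable X]setTI; apply: mB => //.
by move: r0s; rewrite /= in_itv/= => /andP[].
Qed.

Lemma past_setT s : <<s past s >> setT.
Proof. exact: (@measurableT _ (g_sigma_algebraType (past s))). Qed.

Lemma past_nd s t : 0 <= s -> s <= t -> <<s past s >> `<=` <<s past t >>.
Proof.
move=> _ st; apply: sub_sigma_algebra2 => _ [r r0s [U mU ->]].
exists r; last by exists U.
by move: r0s; rewrite /= !in_itv/= => /andP[-> /le_trans]; exact.
Qed.

Section increment.
Variables s t : R.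
Hypotheses (s0 : 0 <= s) (st : s < t).
Local Notation dB := (incr B s t).
Local Notation sigma := (Num.sqrt (t - s)).

Let sigma_gt0 : 0 < sigma. Proof. by rewrite sqrtr_gt0 subr_gt0. Qed.

Let sigma2 : sigma ^+ 2 = t - s.
Proof. by rewrite sqr_sqrtr// subr_ge0 ltW. Qed.

Lemma measurable_brownian_incr : measurable_fun setT dB.
Proof.
have [mB _ _ _] := HB.
by apply: measurable_funB; apply: mB => //; rewrite (le_trans s0)// ltW.
Qed.

Lemma brownian_incr_indep A U : <<s past s >> A -> measurable U ->
  P (A `&` dB @^-1` U) = (P A * P (dB @^-1` U))%E.
Proof.
move=> KA mU; have [_ _ _ indep] := HB.
have lawE := indep s t setT U s0 st (@past_setT s) mU.
rewrite setTI probability_setT mul1e in lawE.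
by rewrite [LHS](indep s t A U)// -lawE.
Qed.

Lemma ge0_integral_brownian_incr (g : R -> R) : measurable_fun setT g ->
  (forall y, 0 <= g y) ->
  (\int[P]_w (g (dB w))%:E =
   \int[lebesgue_measure]_y (g y * normal_pdf 0 sigma y)%:E)%E.
Proof.
move=> mg g0; have [_ _ _ indep] := HB.
have mdBR : measurable_fun setT (dB : T -> measurableTypeR R).
  exact: measurable_brownian_incr.
pose law := measure_function_pushforward__canonical__measure_function_Measure P mdBR.
transitivity (\int[law]_y (g y)%:E)%E.
  have mgE : measurable_fun setT (EFin \o g : measurableTypeR R -> \bar R).
    exact/measurable_EFinP.
  have gE0 : {in setT, forall y, 0 <= (EFin \o g) y}%E by move=> y _; rewrite lee_fin.
  have := ge0_integral_pushforward mdBR P measurableT mgE gE0.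
  by rewrite preimage_setT => <-.
apply: ge0_integral_density => //.
- exact: measurable_normal_pdf.
- by move=> y; exact: normal_pdf_ge0.
- move=> U mU; have := indep s t setT U s0 st (@past_setT s) mU.
  by rewrite setTI probability_setT mul1e.
Qed.

Lemma integral_sqr_brownian_incr :
  (\int[P]_w (dB w ^+ 2)%:E = (t - s)%:E)%E.
Proof.
rewrite (ge0_integral_brownian_incr (g := fun y => y ^+ 2)).
- by rewrite integral_sqr_normal// sigma2.
- exact: exprn_measurable.
- by move=> y; exact: sqr_ge0.
Qed.

Lemma brownian_incr_L2 : dB \in Lfun P 2%:E.
Proof.
apply: L2_sqr_integrableP; first exact: measurable_brownian_incr.
apply/integrableP; split.
  exact/measurable_EFinP/measurable_funX/measurable_brownian_incr.
under eq_integral do rewrite /= ger0_norm ?sqr_ge0//.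
by rewrite integral_sqr_brownian_incr ltry.
Qed.

Lemma integral_brownian_incr : (\int[P]_w (dB w)%:E = 0)%E.
Proof.
rewrite -(integral_id_normal sigma_gt0) [LHS]integralE [RHS]integralE.
congr (_ - _)%E.
- transitivity (\int[P]_w (Num.max (dB w) 0)%:E)%E.
    by apply: eq_integral => w _; rewrite funeposE EFin_max.
  rewrite (ge0_integral_brownian_incr (g := fun y => Num.max y 0)).
  + apply: eq_integral => y _; rewrite funeposE -EFin_max.
    by rewrite maxr_pMl ?mul0r// normal_pdf_ge0.
  + exact: measurable_maxr.
  + by move=> y; rewrite le_max lexx orbT.
- transitivity (\int[P]_w (Num.max (- dB w) 0)%:E)%E.
    by apply: eq_integral => w _; rewrite funenegE EFin_max.
  rewrite (ge0_integral_brownian_incr (g := fun y => Num.max (- y) 0)).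
  + apply: eq_integral => y _; rewrite funenegE -EFinN -EFin_max.
    by rewrite maxr_pMl ?mul0r ?mulNr// normal_pdf_ge0.
  + by apply: measurable_maxr => //; exact: measurableT_comp.
  + by move=> y; rewrite le_max lexx orbT.
Qed.

(* Independence, read as a statement about the sigma-algebra of the increment:
   there [\1_A] and the constant [P A] have the same integrals. *)
Let KdB := preimage_set_system setT dB (@measurable _ (measurableTypeR R)).

Let KdBE C : <<s KdB >> C -> exists2 U, measurable U & C = dB @^-1` U.
Proof.
have KdB_sigma := sigma_algebra_preimage setT dB
  (sigma_algebra_measurable (measurableTypeR R)).
by rewrite (sigma_algebra_id KdB_sigma) => -[U mU <-]; exists U; rewrite ?setTI.
Qed.

Let sub_KdB : <<s KdB >> `<=` measurable.
Proof.
move=> _ /KdBE[U mU ->].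
by have := measurable_brownian_incr measurableT mU; rewrite setTI.
Qed.

Let mdB : measurable_fun setT (dB : g_sigma_algebraType KdB -> R).
Proof. by move=> _ U mU; apply: sub_sigma_algebra; exists U. Qed.

Lemma brownian_incr_indic A C : <<s past s >> A -> <<s KdB >> C ->
  (\int[P]_(w in C) (\1_A w)%:E = \int[P]_(w in C) (fine (P A))%:E)%E.
Proof.
move=> KA KC; have mA := sub_past s0 KA; have mC := sub_KdB KC.
rewrite integral_indic// integral_cst//.
have [U mU ->] := KdBE KC.
by rewrite [LHS](brownian_incr_indep KA mU) fineK// fin_num_measure.
Qed.

Lemma brownian_incr_var A : <<s past s >> A ->
  (\int[P]_(w in A) (dB w ^+ 2)%:E = \int[P]_(w in A) (t - s)%:E)%E.
Proof.
move=> KA; have mA := sub_past s0 KA.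
rewrite integral_cst// integral_indicl//; under eq_integral do rewrite mulrC.
rewrite (@ge0_integral_mul_sub _ _ _ P KdB sub_KdB (\1_A) (cst (fine (P A)))
  (fun w => dB w ^+ 2)) //.
- under eq_integral do rewrite /= EFinM.
  rewrite ge0_integralZr//.
  + by rewrite integral_sqr_brownian_incr fineK// fin_num_measure.
  + exact/measurable_EFinP/measurable_funX/measurable_brownian_incr.
  + by move=> w _; rewrite lee_fin sqr_ge0.
  + by rewrite lee_fin fine_ge0.
- by move=> w; rewrite /= fine_ge0.
- exact: measurable_funX.
- by move=> w; exact: sqr_ge0.
- by move=> C KC; exact: brownian_incr_indic.
Qed.

Lemma brownian_incr_mean A : <<s past s >> A ->
  (\int[P]_(w in A) (dB w)%:E = 0)%E.
Proof.
move=> KA; have mA := sub_past s0 KA.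
have PT : P setT = 1%E by exact: probability_setT.
pose g w := \1_A w - fine (P A).
have i1A : P.-integrable setT (EFin \o \1_A) by exact: integrable_indic.
have ic : P.-integrable setT (EFin \o cst (fine (P A))).
  exact: finite_measure_integrable_cst.
have ig : P.-integrable setT (EFin \o g) by have := integrableB measurableT i1A ic; exact.
have dBL := brownian_incr_L2.
have i1AL : (\1_A : T -> R) \in Lfun P 2%:E.
  apply: L2_sqr_integrableP; first exact: measurable_indic.
  have := i1A; congr (integrable _ _ _); apply/funext => w /=.
  by rewrite indicE; case: (_ \in _); rewrite ?expr1n ?expr0n.
have gL : g \in Lfun P 2%:E.
  by have := L2B i1AL (L2_cst PT (fine (P A))); exact.
have g0 C : <<s KdB >> C -> (\int[P]_(w in C) (g w)%:E = 0)%E.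
  move=> KC; have mC := sub_KdB KC.
  under eq_integral do rewrite EFinB.
  rewrite integralB//; try exact: integrableS (subsetT _) _.
  rewrite brownian_incr_indic// subee//.
  by apply: integrable_fin_num => //; exact: integrableS (subsetT _) _.
have E := integral_mul_sub_eq0 sub_KdB mdB ig (ip_integrable dBL gL) g0.
have i1AdB := ip_integrable i1AL dBL; have icdB := ip_integrable (L2_cst PT (fine (P A))) dBL.
rewrite integral_indicl//.
have -> : (\int[P]_w (\1_A w * dB w)%:E =
    \int[P]_w ((dB w * g w)%:E + (fine (P A) * dB w)%:E))%E.
  by apply: eq_integral => w _; rewrite -EFinD /g; congr EFin; ring.
rewrite integralD//; last exact: ip_integrable.
rewrite -[X in (X + _)%E]fineK; last first.
  exact: integrable_fin_num (ip_integrable dBL gL).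
rewrite -[fine _]/(\int[P]_w (dB w * g w)) E add0e.
under eq_integral do rewrite EFinM.
rewrite integralZl ?integral_brownian_incr ?mule0//.
by have := ip_integrable (L2_cst PT 1) dBL;
  congr (integrable _ _ _); apply/funext => w /=; rewrite mul1r.
Qed.

End increment.

Lemma brownian_normal_incr : normal_incr P past B.
Proof.
have PT : P setT = 1%E by exact: probability_setT.
have incr0 s w : incr B s s w = 0 by rewrite /incr subrr.
split.
- move=> t t0 _ U mU; rewrite setTI; apply: sub_sigma_algebra.
  by exists t; [rewrite /= in_itv/= t0 lexx|exists U].
- move=> s t s0; rewrite le_eqVlt => /predU1P[->|st]; last exact: brownian_incr_L2.
  by apply: eq_L2 (L20 P) => w; rewrite incr0.
- move=> s t A s0; rewrite le_eqVlt => /predU1P[->|st] KA.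
    by rewrite integral0_eq// => w _; rewrite incr0.
  exact: brownian_incr_mean.
- move=> s t A s0; rewrite le_eqVlt => /predU1P[->|st] KA.
    by apply: eq_integral => w _; rewrite incr0 subrr expr0n.
  exact: brownian_incr_var.
Qed.

End brownian.

(** * Normal martingales and product spaces *)

Section normal_martingale.
Context d (T : measurableType d) (R : realType).
Variables (P : probability T R) (G : R -> set (set T)) (M : R -> T -> R).
Hypotheses (HG : filtration G) (HM : normal_martingale P G M).

Lemma filtration_id s : 0 <= s -> <<s G s >> = G s.
Proof. by move=> s0; have [GS _ _] := HG; exact/sigma_algebra_id/GS. Qed.

Lemma sub_filtration s : 0 <= s -> <<s G s >> `<=` measurable.
Proof. by move=> s0; rewrite filtration_id//; have [_ + _] := HG; exact. Qed.

Lemma filtration_nd s t : 0 <= s -> s <= t -> <<s G s >> `<=` <<s G t >>.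
Proof.
move=> s0 st; rewrite !filtration_id//; last exact: le_trans st.
by have [_ _] := HG; exact.
Qed.

Lemma martingale_centered (X : R -> T -> R) s t : martingale P G X ->
  0 <= s -> s <= t -> centered P (G s) (fun w => X t w - X s w).
Proof.
move=> [XL _ XE] s0 st; have t0 := le_trans s0 st.
have iX r : 0 <= r -> P.-integrable setT (EFin \o X r).
  by move=> r0; apply/Lfun1_integrable; exact: XL.
split.
  by have := integrableB measurableT (iX t t0) (iX s s0); exact.
move=> A KA; have mA := sub_filtration s0 KA.
have iXA r : 0 <= r -> P.-integrable A (EFin \o X r).
  by move=> r0; apply: integrableS (subsetT _) (iX r r0).
under eq_integral do rewrite EFinB.
rewrite integralB// ?iXA// (XE s t A)//; last by rewrite -filtration_id.
by rewrite subee//; apply: integrable_fin_num => //; exact: iXA.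
Qed.

Lemma martingale_normal_incr : normal_incr P G M.
Proof.
have [Mmart ML _ M2mart] := HM.
have PT : P setT = 1%E by exact: probability_setT.
have incrL s t : 0 <= s -> s <= t -> incr M s t \in Lfun P 2%:E.
  by move=> s0 st; apply: L2B; apply: ML => //; exact: le_trans st.
have mM t : 0 <= t -> measurable_fun setT (M t : g_sigma_algebraType (G t) -> R).
  move=> t0 _ U mU; rewrite setTI; apply: sub_sigma_algebra.
  by have [_ + _] := Mmart; exact.
split => //.
- by move=> s t A s0 st KA; exact: (martingale_centered Mmart s0 st).2.
move=> s t A s0 st KA.
apply: (integral_of_centered PT (sub_filtration s0)) KA.
have subG := sub_filtration s0.
have cM := martingale_centered Mmart s0 st.
have iMM := ip_integrable (ML s s0) (incrL s t s0 st).
have cMM := centered_mul subG cM (mM s s0) iMM.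
apply: eq_centered (centeredD subG (martingale_centered M2mart s0 st)
  (centeredZ (-2) subG cMM)) => w.
by rewrite /incr; ring.
Qed.

End normal_martingale.

Section rotation.
Context d1 d2 (W1 : measurableType d1) (W2 : measurableType d2) (R : realType).
Variables (P1 : probability W1 R) (P2 : probability W2 R).
Local Notation P := (P1 \x P2)%E.

Lemma product_probability_setT : P setT = 1%E.
Proof. transitivity (P1 setT * P2 setT)%E; last by rewrite !probability_setT mule1.
by rewrite -setXTT; exact: product_measure1E. Qed.

Lemma integrable_tensor (f : W1 -> R) (g : W2 -> R) :
  P1.-integrable setT (EFin \o f) -> P2.-integrable setT (EFin \o g) ->
  P.-integrable setT (fun z => (f z.1 * g z.2)%:E).
Proof.
move=> if_ ig.
have mf : measurable_fun setT f by apply/measurable_EFinP; exact: measurable_int if_.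
have mg : measurable_fun setT g by apply/measurable_EFinP; exact: measurable_int ig.
have mfg : measurable_fun setT (fun z : W1 * W2 => (f z.1 * g z.2)%:E).
  apply/measurable_EFinP/measurable_funM; exact: measurableT_comp.
apply/(@integrable12ltyP _ _ _ _ _ P1 P2 _ mfg).
under eq_integral => x _.
  under eq_integral => y _ do rewrite /= normrM EFinM.
  rewrite ge0_integralZl ?lee_fin//; last first.
    exact/measurable_EFinP/measurableT_comp.
  over.
rewrite ge0_integralZr//; last 2 first.
- exact/measurable_EFinP/measurableT_comp.
- by apply: integral_ge0 => y _; rewrite lee_fin.
have /integrableP[_ f_lt] := if_; have /integrableP[_ g_lt] := ig.
have f_ge0 : (0 <= \int[P1]_x `|f x|%:E)%E.
  by apply: integral_ge0 => x _; rewrite lee_fin.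
by apply: lte_mul_pinfty => //; rewrite ge0_fin_numE.
Qed.

Lemma integral_tensor (f : W1 -> R) (g : W2 -> R) :
  P1.-integrable setT (EFin \o f) -> P2.-integrable setT (EFin \o g) ->
  (\int[P]_z (f z.1 * g z.2)%:E = \int[P1]_x (f x)%:E * \int[P2]_y (g y)%:E)%E.
Proof.
move=> if_ ig; rewrite -integral12_prod_meas1; last exact: integrable_tensor.
rewrite /fubini_F /=.
under eq_integral => x _.
  under eq_integral => y _ do rewrite EFinM.
  rewrite integralZl//; over.
have gE : (\int[P2]_y (g y)%:E = (fine (\int[P2]_y (g y)%:E))%:E)%E.
  by rewrite fineK//; exact: integrable_fin_num ig.
by rewrite /= gE -integralZr.
Qed.

Lemma L2_tensor (f : W1 -> R) (g : W2 -> R) :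
  f \in Lfun P1 2%:E -> g \in Lfun P2 2%:E ->
  (fun z => f z.1 * g z.2) \in Lfun P 2%:E.
Proof.
move=> fL gL; apply: L2_sqr_integrableP.
  apply: measurable_funM.
    exact: measurableT_comp (L2_measurable fL) measurable_fst.
  exact: measurableT_comp (L2_measurable gL) measurable_snd.
under eq_fun do rewrite exprMn.
exact: (integrable_tensor (Lfun2_integrable_sqr fL) (Lfun2_integrable_sqr gL)).
Qed.

Variables (K1 : set (set W1)) (K2 : set (set W2)).
Hypotheses (subK1 : <<s K1 >> `<=` measurable) (subK2 : <<s K2 >> `<=` measurable).

Definition product_past : set (set (W1 * W2)) :=
  [set A | exists2 A1, <<s K1 >> A1 & exists2 A2, <<s K2 >> A2 & A = A1 `*` A2].

Lemma sub_product_past : <<s product_past >> `<=` measurable.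
Proof.
apply: smallest_sub; first exact: sigma_algebra_measurable.
move=> _ [A1 /subK1 mA1 [A2 /subK2 mA2 ->]]; exact: measurableX.
Qed.

Lemma centered_tensor (f : W1 -> R) (g : W2 -> R) :
  P1.-integrable setT (EFin \o f) -> P2.-integrable setT (EFin \o g) ->
  centered P1 K1 f \/ centered P2 K2 g ->
  centered P product_past (fun z => f z.1 * g z.2).
Proof.
move=> if_ ig cfg; apply: centered_pi_system.
- exact: sub_product_past.
- move=> _ _ [A1 K1A [A2 K2A ->]] [A1' K1A' [A2' K2A' ->]].
  exists (A1 `&` A1'); first exact: (@measurableI _ (g_sigma_algebraType K1)).
  exists (A2 `&` A2'); first exact: (@measurableI _ (g_sigma_algebraType K2)).
  by rewrite setXI.
- exists setT; first exact: (@measurableT _ (g_sigma_algebraType K1)).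
  exists setT; first exact: (@measurableT _ (g_sigma_algebraType K2)).
  by rewrite setXTT.
- exact: integrable_tensor.
move=> _ [A1 KA1 [A2 KA2 ->]]; have [mA1 mA2] := (subK1 KA1, subK2 KA2).
rewrite integral_indicl; last exact: measurableX.
transitivity (\int[P]_z ((\1_A1 z.1 * f z.1) * (\1_A2 z.2 * g z.2))%:E)%E.
  apply: eq_integral => z _; congr EFin; rewrite [\1_(_ `*` _) _]indicE in_setX.
  by rewrite !indicE -mulnb natrM; ring.
rewrite (integral_tensor (f := fun x => \1_A1 x * f x) (g := fun y => \1_A2 y * g y)).
- by rewrite -!integral_indicl//; case: cfg => -[_ c0]; rewrite c0// ?mul0e ?mule0.
- exact: integrable_indicM.
- exact: integrable_indicM.
Qed.

Lemma centered_fst (f : W1 -> R) : centered P1 K1 f ->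
  centered P product_past (fun z => f z.1).
Proof.
move=> cf; have i1 : P2.-integrable setT (EFin \o cst 1).
  exact: finite_measure_integrable_cst.
by apply: eq_centered (centered_tensor cf.1 i1 (or_introl cf)) => z; rewrite /= mulr1.
Qed.

Lemma centered_snd (g : W2 -> R) : centered P2 K2 g ->
  centered P product_past (fun z => g z.2).
Proof.
move=> cg; have i1 : P1.-integrable setT (EFin \o cst 1).
  exact: finite_measure_integrable_cst.
by apply: eq_centered (centered_tensor i1 cg.1 (or_intror cg)) => z; rewrite /= mul1r.
Qed.

End rotation.

(** * The rotated martingale *)

Section rotated.
Context d1 d2 (W1 : measurableType d1) (W2 : measurableType d2) (R : realType).
Variables (P1 : probability W1 R) (P2 : probability W2 R).
Local Notation P := (P1 \x P2)%E.
Variables (K1 : R -> set (set W1)) (K2 : R -> set (set W2)).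
Hypotheses (subK1 : forall s : R, 0 <= s -> <<s K1 s >> `<=` measurable)
           (subK2 : forall s : R, 0 <= s -> <<s K2 s >> `<=` measurable).
Hypotheses (ndK1 : forall s t : R, 0 <= s -> s <= t -> <<s K1 s >> `<=` <<s K1 t >>)
           (ndK2 : forall s t : R, 0 <= s -> s <= t -> <<s K2 s >> `<=` <<s K2 t >>).
Variables (B : R -> W1 -> R) (M : R -> W2 -> R).
Hypotheses (nB : normal_incr P1 K1 B) (nM : normal_incr P2 K2 M).

Definition joint_past s := product_past (K1 s) (K2 s).

Lemma sub_joint_past s : 0 <= s -> <<s joint_past s >> `<=` measurable.
Proof. by move=> s0; apply: sub_product_past; [exact: subK1|exact: subK2]. Qed.

Lemma joint_past_nd s t : 0 <= s -> s <= t ->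
  <<s joint_past s >> `<=` <<s joint_past t >>.
Proof.
move=> s0 st; apply: sub_sigma_algebra2 => _ [A1 KA1 [A2 KA2 ->]].
exists A1; first exact: ndK1 KA1.
by exists A2 => //; exact: ndK2 KA2.
Qed.

Local Notation Y := (rotated_martingale B M).

Lemma rotated_incr theta s t z :
  incr (Y theta) s t z = cos theta * incr B s t z.1 + sin theta * incr M s t z.2.
Proof. by rewrite /incr /rotated_martingale; ring. Qed.

Let P1T : P1 setT = 1%E. Proof. exact: probability_setT. Qed.
Let P2T : P2 setT = 1%E. Proof. exact: probability_setT. Qed.

Lemma rotated_incr_L2 theta s t : 0 <= s -> s <= t ->
  incr (Y theta) s t \in Lfun P 2%:E.
Proof.
move=> s0 st.
have BL := L2_tensor (normal_incr_L2 nB s0 st) (L2_cst P2T 1).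
have ML := L2_tensor (L2_cst P1T 1) (normal_incr_L2 nM s0 st).
apply: eq_L2 (L2D (L2Z (cos theta) BL) (L2Z (sin theta) ML)) => z.
by rewrite rotated_incr /= mulr1 mul1r.
Qed.

Lemma rotated_incr_adapted theta t : 0 <= t ->
  adapted joint_past t (Y theta t).
Proof.
move=> t0.
have m1 : measurable_fun setT ((fun z => B t z.1) : g_sigma_algebraType (joint_past t) -> R).
  move=> _ U mU; rewrite setTI; apply: sub_sigma_algebra.
  exists (B t @^-1` U).
    by have := normal_incr_adapted nB t0 measurableT mU; rewrite setTI.
  exists setT; first exact: (@measurableT _ (g_sigma_algebraType (K2 t))).
  by apply/seteqP; split => z // [].
have m2 : measurable_fun setT ((fun z => M t z.2) : g_sigma_algebraType (joint_past t) -> R).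
  move=> _ U mU; rewrite setTI; apply: sub_sigma_algebra.
  exists setT; first exact: (@measurableT _ (g_sigma_algebraType (K1 t))).
  exists (M t @^-1` U); last by apply/seteqP; split => z // [].
  by have := normal_incr_adapted nM t0 measurableT mU; rewrite setTI.
by apply: measurable_funD; exact: measurable_funM.
Qed.

Let centered_incr d (W : measurableType d) (Q : probability W R) K X s t :
  (forall r : R, 0 <= r -> <<s K r >> `<=` measurable) ->
  normal_incr Q K X -> 0 <= s -> s <= t -> centered Q (K s) (incr X s t).
Proof.
move=> subK nX s0 st; split; last by move=> A; exact: normal_incr_mean.
have QT : Q setT = 1%E by exact: probability_setT.
have := ip_integrable (L2_cst QT 1) (normal_incr_L2 nX s0 st).
by congr (integrable _ _ _); apply/funext => w /=; rewrite mul1r.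
Qed.

Let centered_var d (W : measurableType d) (Q : probability W R) K X s t :
  (forall r : R, 0 <= r -> <<s K r >> `<=` measurable) ->
  normal_incr Q K X -> 0 <= s -> s <= t ->
  centered Q (K s) (fun w => incr X s t w * incr X s t w - 1 * (t - s)).
Proof.
move=> subK nX s0 st.
have QT : Q setT = 1%E by exact: probability_setT.
split; last by move=> A; exact: (correlated_incr_self QT subK nX).
have XL := normal_incr_L2 nX s0 st.
by have := integrableB measurableT (ip_integrable XL XL)
  (ip_integrable (L2_cst QT 1) (L2_cst QT (t - s))); exact.
Qed.

Lemma centered_rotated_incr theta s t : 0 <= s -> s <= t ->
  centered P (joint_past s) (incr (Y theta) s t).
Proof.
move=> s0 st; have subK := sub_joint_past s0.
have cB := centered_fst P2 (subK1 s0) (subK2 s0) (centered_incr subK1 nB s0 st).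
have cM := centered_snd P1 (subK1 s0) (subK2 s0) (centered_incr subK2 nM s0 st).
apply: eq_centered (centeredD subK (centeredZ (cos theta) subK cB)
  (centeredZ (sin theta) subK cM)) => z.
by rewrite rotated_incr.
Qed.

Lemma centered_rotated_covar theta theta' s t : 0 <= s -> s <= t ->
  centered P (joint_past s) (fun z =>
    incr (Y theta) s t z * incr (Y theta') s t z - cos (theta - theta') * (t - s)).
Proof.
move=> s0 st; have subK := sub_joint_past s0.
have cBB := centered_fst P2 (subK1 s0) (subK2 s0) (centered_var subK1 nB s0 st).
have cMM := centered_snd P1 (subK1 s0) (subK2 s0) (centered_var subK2 nM s0 st).
have cB := centered_incr subK1 nB s0 st; have cM := centered_incr subK2 nM s0 st.
have cBM := centered_tensor (subK1 s0) (subK2 s0) cB.1 cM.1 (or_introl cB).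
have := centeredD subK (centeredD subK
  (centeredZ (cos theta * cos theta') subK cBB)
  (centeredZ (sin theta * sin theta') subK cMM))
  (centeredZ (cos theta * sin theta' + sin theta * cos theta') subK cBM).
apply: eq_centered => z; rewrite !rotated_incr cosB; ring.
Qed.

Lemma rotated_normal_incr theta : normal_incr P joint_past (Y theta).
Proof.
split.
- exact: rotated_incr_adapted.
- by move=> s t; exact: rotated_incr_L2.
- by move=> s t A s0 st; exact: (centered_rotated_incr theta s0 st).2.
- move=> s t A s0 st.
  apply: (integral_of_centered (product_probability_setT P1 P2) (sub_joint_past s0)).
  apply: eq_centered (centered_rotated_covar theta theta s0 st) => z.
  by rewrite subrr cos0 mul1r expr2.
Qed.

Lemma rotated_correlated theta theta' :
  correlated_incr P joint_past (cos (theta - theta')) (Y theta) (Y theta').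
Proof. by move=> s t A s0 st; exact: (centered_rotated_covar _ _ s0 st).2. Qed.

End rotated.

Section differentiability.
Context (R : realType).

(* Since [1 - c ^ n = (1 - c) (1 + ... + c ^ (n - 1))] with [c = cos h] and
   [1 - c >= (sin h) ^ 2 / 2]. *)
Lemma cosX_near0 N : \forall h \near (0 : R)^', forall n, (n <= N)%N ->
  n%:R * h ^+ 2 / 16 <= 1 - cos h ^+ n.
Proof.
have near_cos : \forall h \near (0 : R)^', 2^-1 < cos h ^+ N.
  have : cos h ^+ N @[h --> (0 : R)^'] --> cos 0 ^+ N.
    apply: cvg_within_filter.
    apply: (@continuous_comp _ _ _ (@cos R) (fun x => x ^+ N)).
      exact: continuous_cos.
    exact: exprn_continuous.
  rewrite cos0 expr1n => /cvgr_gt; apply; lra.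
have near_cos0 : \forall h \near (0 : R)^', 0 < cos h.
  have : cos h @[h --> (0 : R)^'] --> cos 0.
    by apply: cvg_within_filter; exact: continuous_cos.
  by rewrite cos0 => /cvgr_gt; apply.
have near_sin : \forall h \near (0 : R)^', 2^-1 < h^-1 * sin h.
  have [dsin sin'E] := is_derive_sin (0 : R).
  have : h^-1 *: ((sin \o shift 0) (h *: 1) - sin 0) @[h --> (0 : R)^'] --> 'D_1 (@sin R) 0.
    exact: dsin.
  rewrite sin'E cos0 => /cvgr_gt/(_ 2^-1); have /[swap]/[apply] : (2^-1 : R) < 1 by lra.
  apply: filterS => h; rewrite /= sin0 subr0 /shift /= addr0.
  by rewrite /GRing.scale/= mulr1.
have near_neq0 : \forall h \near (0 : R)^', h != 0 by exact: nbhs_dnbhs_neq.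
apply: filterS2 near_neq0 (filterI near_cos (filterI near_cos0 near_sin)).
move=> h h0 [cN [c0 sh]] n nN.
have c1 : cos h <= 1 by exact: cos_le1.
have sin_ge : h ^+ 2 / 4 <= sin h ^+ 2.
  have -> : sin h = (h^-1 * sin h) * h by rewrite mulrAC mulVf ?mul1r.
  rewrite exprMn mulrC ler_wpM2r ?sqr_ge0//.
  by rewrite (_ : 4^-1 = 2^-1 ^+ 2) ?lerXn2r ?nnegrE ?(ltW sh)//; [lra..|field].
have cos_le : h ^+ 2 / 8 <= 1 - cos h.
  have := cos2Dsin2 h; nra.
have sum_ge : n%:R / 2 <= \sum_(i < n) cos h ^+ i.
  rewrite (_ : n%:R / 2 = \sum_(i < n) 2^-1); last first.
    by rewrite sumr_const card_ord mulr_natl.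
  apply: ler_sum => i _; apply: le_trans (ltW cN) _.
  by apply: ler_wiXn2l; rewrite ?(ltW c0)// (leq_trans (ltnW (ltn_ord i))).
rewrite -opprB subrX1 -mulNr opprB.
rewrite (_ : _ / 16 = (h ^+ 2 / 8) * (n%:R / 2)); last by field.
by apply: ler_pM => //; rewrite divr_ge0 ?sqr_ge0.
Qed.

Lemma ip_add_le d (T : measurableType d) (mu : {measure set T -> \bar R}) (f g : T -> R) :
  f \in Lfun mu 2%:E -> g \in Lfun mu 2%:E ->
  ip mu (fun x => f x + g x) (fun x => f x + g x) <= 2 * (ip mu f f + ip mu g g).
Proof.
move=> fL gL; have := ip_ge0 mu (fun x => f x - g x).
rewrite ipBl ?ipBr ?L2B// ipDl ?ipDr ?L2D// (ipC mu g f).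
lra.
Qed.

(* Only boundedness of the difference quotients is used. *)
Lemma L2_differentiable_bound d (T : measurableType d)
    (mu : {measure set T -> \bar R}) (Phi : R -> T -> R) x0 :
  (forall x, Phi x \in Lfun mu 2%:E) -> L2_differentiable_at mu Phi x0 ->
  exists C, \forall h \near (0 : R)^',
    ip mu (fun w => Phi (x0 + h) w - Phi x0 w) (fun w => Phi (x0 + h) w - Phi x0 w)
    <= C * h ^+ 2.
Proof.
move=> PhiL [D DL cD]; exists (2 * (1 + ip mu D D)).
have near_lt1 : \forall h \near (0 : R)^',
    (L2norm mu (fun w => (h^-1 * (Phi (x0 + h) w - Phi x0 w) - D w)%R) < 1%:E)%E.
  move/fine_cvgP : cD => [fin_near /cvgr_lt/(_ 1 ltr01) lt_near].
  apply: filterS2 fin_near lt_near => h fin lt; rewrite -(fineK fin) lte_fin.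
  exact: lt.
have near_neq0 : \forall h \near (0 : R)^', h != 0 by exact: nbhs_dnbhs_neq.
apply: filterS2 near_lt1 near_neq0 => h lt1 h0.
have dL : (fun w => Phi (x0 + h) w - Phi x0 w) \in Lfun mu 2%:E by exact: L2B.
set d_ := (fun w => Phi (x0 + h) w - _) in dL *.
have qL : (fun w => h^-1 * d_ w) \in Lfun mu 2%:E by exact: L2Z.
have rL := L2B qL DL.
have r1 : ip mu (fun w => h^-1 * d_ w - D w) (fun w => h^-1 * d_ w - D w) <= 1.
  move: lt1; rewrite (L2norm_sqrt rL) lte_fin => /ltW.
  by rewrite -[X in _ <= X -> _]sqrtr1 ler_sqrt.
have q_le : ip mu (fun w => h^-1 * d_ w) (fun w => h^-1 * d_ w) <= 2 * (1 + ip mu D D).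
  have := ip_add_le rL DL; under eq_fun do rewrite subrK.
  move/le_trans; apply.
  by rewrite ler_pM2l// lerD2r.
move: q_le; rewrite ipZl// ipZr// mulrA -expr2 exprVn mulrC ler_pdivrMr//.
by rewrite exprn_even_gt0.
Qed.

End differentiability.

Lemma OU_sum_finite (R : realType) (f : forall n, n.-tuple R -> R) (C : R) :
  (forall n, symmetric_L2_kernel (f n)) ->
  (forall N, \sum_(n < N) n%:R * chaos_norm2 f n <= C) ->
  (\sum_(0 <= n <oo) (n * n`!)%:R%:E * kernel_norm (f n) ^+ 2 < +oo)%E.
Proof.
move=> symf leC.
have kernelE n : (kernel_norm (f n) ^+ 2 = (ip (lebesgue_tuple R n)
    (f n \_ (@orthant R n)) (f n \_ (@orthant R n)))%:E)%E.
  by apply: L2norm_sqr; case: (symf n).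
apply: (@le_lt_trans _ _ C%:E); last exact: ltry.
apply: lime_le.
  apply: is_cvg_nneseries => n _ _.
  by rewrite kernelE -EFinM lee_fin mulr_ge0 ?ip_ge0.
apply: nearW => N.
under eq_bigr do rewrite kernelE -EFinM.
rewrite sumEFin lee_fin; apply: le_trans (leC N).
rewrite big_mkord; apply: ler_sum => n _.
rewrite natrM -mulrA ler_wpM2l//.
have := ler_wpM2l (ler0n R n`!) (le_kernel_norm_simplex (symf n)).
by rewrite mulrA -expr2.
Qed.

Theorem proposition6 (R : realType) (d1 d2 : measure_display)
    (W1 : measurableType d1) (W2 : measurableType d2)
    (P1 : probability W1 R) (P2 : probability W2 R)
    (B : R -> W1 -> R) (HB : wiener_space P1 B)
    (G : R -> set (set W2)) (HG : filtration G)
    (M : R -> W2 -> R) (HM : normal_martingale P2 G M)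
    (F : W1 -> R) (HF : F \in Lfun P1 2%:E)
    (Fx : R -> W1 * W2 -> R) (HFx : chaotic_extension P1 P2 B M F Fx)
    (theta0 : R)
    (Hdiff : L2_differentiable_at (P1 \x P2)%E Fx theta0) :
  OU_domain P1 B F.
Proof.
have [f [symf sumF sumFx]] := HFx; exists f; split => //.
have HB' := HB.1; pose K := joint_past (past B) G.
have nB := brownian_normal_incr HB'; have nM := martingale_normal_incr HG HM.
have subB := sub_past HB'; have subG := sub_filtration HG.
have PT := product_probability_setT P1 P2.
have subK : forall s : R, 0 <= s -> <<s K s >> `<=` measurable.
  by move=> s; exact: (sub_joint_past subB subG).
have ndK : forall s t : R, 0 <= s -> s <= t -> <<s K s >> `<=` <<s K t >>.
  by move=> s t; apply: joint_past_nd; [exact: past_nd|exact: filtration_nd].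
have nY theta := rotated_normal_incr subB subG nB nM theta.
have cY theta theta' := rotated_correlated subB subG nB nM theta theta'.
have [C boundC] := L2_differentiable_bound (fun x => (sumFx x).1) Hdiff.
apply: (@OU_sum_finite _ _ (8 * C)) => // N.
have near_neq0 : \forall h \near (0 : R)^', h != 0 by exact: nbhs_dnbhs_neq.
pose dF h w := Fx (theta0 + h) w - Fx theta0 w.
have [h [h0 hC hcos]] : exists h : R, [/\ h != 0,
    ip (P1 \x P2)%E (dF h) (dF h) <= C * h ^+ 2
    & forall n, (n <= N)%N -> n%:R * h ^+ 2 / 16 <= 1 - cos h ^+ n].
  apply: (@filter_ex _ (0 : R)^').
  by apply: filterS3 near_neq0 boundC (cosX_near0 R N) => h; split.
have h2 : 0 < h ^+ 2 by rewrite exprn_even_gt0.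
have := chaos_increment_ge PT subK ndK symf N (nY (theta0 + h)) (nY theta0)
  (cY _ _) (cos_max _) (sumFx _) (sumFx _).
rewrite [theta0 + h]addrC addrK addrC => /le_trans/(_ hC).
move=> sum_le.
have sum_ge : (\sum_(n < N) n%:R * chaos_norm2 f n) * (h ^+ 2 / 8) <=
    \sum_(n < N) 2 * (1 - cos h ^+ n) * chaos_norm2 f n.
  rewrite mulr_suml; apply: ler_sum => n _.
  have := ler_wpM2r (chaos_norm2_ge0 f n) (hcos n (ltnW (ltn_ord n))); lra.
rewrite -(ler_pM2r h2); have := le_trans sum_ge sum_le; lra.
Qed.
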